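(* Under the Gamma/Beta-prime approximation described in the context, the ergodic rate of the center user $\mathcal{R}_{i,c} = \int_{0}^{\infty} \log_2(1 + x) f_{\gamma_{i,c}}(x)\, dx$ is given by \[ \mathcal{R}_{i,c} = \frac{1}{\ln(2)\Lambda_{i,c}}\,G_{3,3}^{3,2}\left(\frac{\theta_{\mathcal{W}_{i,c}}}{\rho\zeta_{i,c}\theta_{Z_{i,c}}}\,\bigg\vert \begin{array}{c} 0,\,1-k_{\mathcal{W}_{i,c}},\,1 \\ 0,\,0,\,k_{Z_{i,c}} \end{array} \right), \] where $G_{p,q}^{m,n}(\cdot)$ is the Meijer G-function, $\Lambda_{i,c}=B(k_{Z_{i,c}},k_{\mathcal{W}_{i,c}})\,\Gamma(\kappa_{i,c})$, $\kappa_{i,c}=k_{Z_{i,c}}+k_{\mathcal{W}_{i,c}}$, and $B(\cdot,\cdot)$ is the Euler Beta function.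
   Context: Downlink two-cell STAR-RIS assisted CoMP-NOMA network: base stations BS$_i$, $i\in\{1,2\}$, each serve a two-user NOMA pair of its cell-center user U$_{c_i}$ and a shared edge user; U$_{c_i}$ suffers inter-cell interference from the other base station BS$_{i'}$, $i'\neq i$. A STAR-RIS with $K$ elements (energy-splitting, amplitude coefficient $\beta$) assists the links. With Nakagami-$m$ fading, the effective channel power gain $Z_{i,c}=(|h_{i,c}|+\sqrt{\beta}\sum_{k=1}^K|h_{R,c}||h_{i,R}|)^2$ is approximated (large $K$, moment matching) by a Gamma random variable with shape $k_{Z_{i,c}}$ and scale $\theta_{Z_{i,c}}$. With transmit SNR $\rho$ and center-user power-allocation factor $\zeta_{i,c}$, the SINR of U$_{c_i}$ for decoding its own message (after SIC) is $\gamma_{i,c}=\rho\zeta_{i,c}Z_{i,c}/\mathcal{W}_{i,c}$ with $\mathcal{W}_{i,c}=\rho|h_{i',c}|^2+1$ (interference plus normalized noise), where $|h_{i',c}|$ is Nakagami-$m$. $\mathcal{W}_{i,c}$ is approximated by a Gamma RV with shape $k_{\mathcal{W}_{i,c}}=\mu^2/(\mu^{(2)}-\mu^2)$ and scale $\theta_{\mathcal{W}_{i,c}}=(\mu^{(2)}-\mu^2)/\mu$ from its first two moments $\mu,\mu^{(2)}$. Consequently $\gamma_{i,c}$ is approximately Beta-prime distributed with PDF $f_{\gamma_{i,c}}(x)=\frac{\theta_{\mathcal{W}_{i,c}}}{\rho\zeta_{i,c}\theta_{Z_{i,c}}B(k_{Z_{i,c}},k_{\mathcal{W}_{i,c}})}\left(\frac{x\theta_{\mathcal{W}_{i,c}}}{\rho\zeta_{i,c}\theta_{Z_{i,c}}}\right)^{k_{Z_{i,c}}-1}\left(1+\frac{x\theta_{\mathcal{W}_{i,c}}}{\rho\zeta_{i,c}\theta_{Z_{i,c}}}\right)^{-(k_{Z_{i,c}}+k_{\mathcal{W}_{i,c}})}$,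 $x>0$. *)

(* Defs.v *)
From Stdlib Require Import Reals List Factorial.
From Coquelicot Require Import Coquelicot.
Import ListNotations.
Open Scope R_scope.

Definition Cpowr (x : R) (s : C) : C :=
  (exp (Re s * ln x) * cos (Im s * ln x), exp (Re s * ln x) * sin (Im s * ln x)).

Fixpoint Cprod_list (l : list C) : C :=
  match l with nil => RtoC 1 | x :: r => Cmult x (Cprod_list r) end.

(* Gauss' limit formula: Gamma(s) = lim_n n! n^s / (s (s+1) ... (s+n)),
   valid for every complex s that is not a nonpositive integer. *)
Definition gauss_seq (s : C) (n : nat) : C :=
  Cdiv (Cmult (RtoC (INR (fact n))) (Cpowr (INR n) s))
       (Cprod_list (map (fun k => Cplus s (RtoC (INR k))) (seq 0 (S n)))).

Definition CGamma (s : C) : C :=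
  (real (Lim_seq (fun n => Re (gauss_seq s n))),
   real (Lim_seq (fun n => Im (gauss_seq s n)))).

Definition Gamma (x : R) : R := Re (CGamma (RtoC x)).

Definition Beta (a b : R) : R :=
  RInt_gen (fun t => Rpower t (a - 1) * Rpower (1 - t) (b - 1))
           (at_right 0) (at_left 1).

(* Meijer G-function G^{m,n}_{p,q}(z | a_1..a_p ; b_1..b_q), with real
   parameters a = [a_1;..;a_p], b = [b_1;..;b_q] and real z > 0, via its
   Mellin--Barnes integral
     G = 1/(2 pi i) int_L  prod_{j<=m} Gamma(b_j - s) prod_{j<=n} Gamma(1 - a_j + s)
                         / (prod_{j>m} Gamma(1 - b_j + s) prod_{j>n} Gamma(a_j - s)) z^s ds. *)
Definition meijerG_integrand (m n : nat) (a b : list R) (z : R) (s : C) : C :=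
  Cmult
    (Cdiv
      (Cmult (Cprod_list (map (fun bj => CGamma (Cminus (RtoC bj) s)) (firstn m b)))
             (Cprod_list (map (fun aj => CGamma (Cplus (RtoC (1 - aj)) s)) (firstn n a))))
      (Cmult (Cprod_list (map (fun bj => CGamma (Cplus (RtoC (1 - bj)) s)) (skipn m b)))
             (Cprod_list (map (fun aj => CGamma (Cminus (RtoC aj) s)) (skipn n a)))))
    (Cpowr z s).

(* The contour L taken as the vertical line Re s = c, which must separate the
   poles of Gamma(b_j - s) (j <= m) from those of Gamma(1 - a_j + s) (j <= n). *)
Definition admissible_line (m n : nat) (a b : list R) (c : R) : Prop :=
  (forall j, (j < m)%nat -> c < nth j b 0) /\
  (forall j, (j < n)%nat -> nth j a 0 - 1 < c).

(* G = v along the line s = c + i t: ds = i dt, so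
   G = (1/(2 pi)) int_{-oo}^{+oo} integrand(c + i t) dt. *)
Definition is_meijerG_line (m n : nat) (a b : list R) (c z : R) (v : C) : Prop :=
  is_RInt_gen (fun t : R => meijerG_integrand m n a b z (c, t))
              (Rbar_locally m_infty) (Rbar_locally p_infty)
              (Cmult (RtoC (2 * PI)) v).

Definition log2 (x : R) : R := ln x / ln 2.

Definition f_gamma (kZ thZ kW thW rho zeta : R) (x : R) : R :=
  let u := x * thW / (rho * zeta * thZ) in
  thW / (rho * zeta * thZ * Beta kZ kW) * Rpower u (kZ - 1)
    * Rpower (1 + u) (- (kZ + kW)).

(* Main.v *)
Require Import Defs.
From Stdlib Require Import Reals List Lra Lia Factorial.
From Coquelicot Require Import Coquelicot.
Import ListNotations.
Open Scope R_scope.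

(* With [z] the argument of the G-function and [s = c + i t], the reflection and beta identities
   for the Gamma function turn the Mellin--Barnes integrand into
     Gamma (kZ + kW) * z^s * int_0^oo y^(s-1) ln (1 + y) dy * int_0^oo v^(kZ-s-1) (1 + v)^(-kZ-kW) dv.
   Fubini and Mellin inversion of [ln (1 + y)] on the line [Re s = c] leave
     2 pi Gamma (kZ + kW) * int_0^oo v^(kZ-1) (1 + v)^(-kZ-kW) ln (1 + v/z) dv,
   which is the rate integral up to the constants.  All Mellin integrals are carried to the whole
   line by [y = e^u].  The inversion is obtained by Abel summation, i.e. from the Poisson kernel
   [2 e / (e^2 + u^2)].  The factor [Beta kZ kW] is the same on both sides, so its value is never
   needed. *)

(** * Improper integrals on the line *)

(** The admissible line puts every Gamma argument, [-s], [1 + s], [kW + s], [kZ - s] and [1 - s], in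
    the right half-plane. There Gauss' limit is Euler's integral, so analytic continuation never
    arises, and reflection takes the form of the beta identity with parameters summing to 1. The
    quotient [Gamma(-s) / Gamma(1 - s) = -1/s] turns its kernel [x / (1 + x)] into [ln (1 + x)], by
    parts. The obstacle is the inversion: on a vertical line [e^(i t u)] has modulus 1, so the
    double integral behind it does not converge absolutely in [t], and Fubini is available only
    after damping by [exp (- e * Rabs t)]. In the final exchange over [t] and [v], absolute
    convergence in [t] comes from the quadratic decay of the Mellin transform of [ln (1 + y)]. Since
    every majorant is [K / (1 + x^2)] or a product of two such, dominated convergence and Fubini
    reduce to Riemann integrals over compact windows. *)

(* The majorant [K / (1 + x ^ 2)] is chosen because its tails are explicit through [atan]; all the
   integrands below decay exponentially or quadratically. *)
Definition dominated (K : R) (f : R -> R) : Prop :=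
  (forall x, continuous f x) /\ (forall x, Rabs (f x) <= K * / (1 + x ^ 2)).

(** A total function, so that integrals can be nested and rewritten without convergence side
    conditions. On dominated integrands it is the genuine improper integral, by
    [is_RInt_gen_intR]. *)
Definition intR (f : R -> R) : R := real (Lim_seq (fun n => RInt f (- INR n) (INR n))).

Lemma cauchy_pos (x : R) : 0 < / (1 + x ^ 2).
Proof. apply Rinv_0_lt_compat. nra. Qed.

Lemma ex_RInt_cont (f : R -> R) (a b : R) :
  (forall x, continuous f x) -> ex_RInt f a b.
Proof. intros H. apply (ex_RInt_continuous (V := R_CompleteNormedModule)). auto. Qed.

Lemma is_RInt_cauchy (a b : R) : is_RInt (fun x => / (1 + x ^ 2)) a b (atan b - atan a).
Proof.
  apply (is_RInt_derive (V := R_CompleteNormedModule) atan).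
  - intros x _. auto_derive; [easy|]. field. nra.
  - intros x _. apply (ex_derive_continuous (V := R_NormedModule)). auto_derive. nra.
Qed.

Lemma RInt_dominated_le (K : R) (f : R -> R) (a b : R) :
  dominated K f -> a <= b -> Rabs (RInt f a b) <= K * (atan b - atan a).
Proof.
  intros [Hc Hb] Hab.
  apply (norm_RInt_le (V := R_NormedModule) f (fun x => K * / (1 + x ^ 2)) a b); auto.
  - apply (RInt_correct (V := R_CompleteNormedModule)). now apply ex_RInt_cont.
  - apply (is_RInt_scal (V := R_NormedModule)), is_RInt_cauchy.
Qed.

Lemma dominated_K_pos (K : R) (f : R -> R) : dominated K f -> 0 <= K.
Proof.
  intros [_ H]. specialize (H 0). pose proof (Rabs_pos (f 0)).
  replace (/ (1 + 0 ^ 2)) with 1 in H by field. lra.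
Qed.

Lemma RInt_split3 (f : R -> R) (a a' b' b : R) :
  (forall x, continuous f x) ->
  RInt f a b = RInt f a a' + RInt f a' b' + RInt f b' b.
Proof.
  intros Hc.
  rewrite <- (RInt_Chasles (V := R_CompleteNormedModule) f a b' b),
    <- (RInt_Chasles (V := R_CompleteNormedModule) f a a' b'); try now apply ex_RInt_cont.
  reflexivity.
Qed.

Lemma RInt_dominated_nested (K : R) (f : R -> R) (a a' b' b : R) :
  dominated K f -> a <= a' -> a' <= b' -> b' <= b ->
  Rabs (RInt f a b - RInt f a' b') <= K * (PI - (atan b' - atan a')).
Proof.
  intros Hf H1 H2 H3. pose proof (dominated_K_pos _ _ Hf) as HK.
  rewrite (RInt_split3 f a a' b' b) by apply Hf.
  replace (_ - _) with (RInt f a a' + RInt f b' b) by ring.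
  eapply Rle_trans; [apply Rabs_triang|].
  pose proof (RInt_dominated_le K f a a' Hf H1).
  pose proof (RInt_dominated_le K f b' b Hf H3).
  pose proof (atan_bound a). pose proof (atan_bound b). nra.
Qed.

Lemma atan_tail (eta : R) : 0 < eta ->
  exists M, 0 < M /\ forall T, M <= T -> 0 < PI - 2 * atan T < eta.
Proof.
  intros He. pose proof PI_RGT_0.
  (* The maximum with [PI / 4] keeps [x] strictly between 0 and [PI / 2], so that [tan x] is
     positive. *)
  set (x := Rmax (PI / 4) (PI / 2 - eta / 4)).
  assert (PI / 4 <= x < PI / 2 /\ PI / 2 - eta / 4 <= x).
  { unfold x. split; [split|]. apply Rmax_l. apply Rmax_lub_lt; lra. apply Rmax_r. }
  exists (tan x). split.
  - apply tan_gt_0; lra.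
  - intros T HT. pose proof (atan_bound T). split; [lra|].
    assert (x <= atan T); [|lra].
    rewrite <- (atan_tan x) by lra. destruct HT as [HT|HT].
    left; now apply atan_increasing. right; now f_equal.
Qed.

(** Nested windows give the Cauchy criterion for the defining sequence; the same estimate, uniform
    in the outer window, then passes to the limit. *)
Lemma intR_tail (K : R) (f : R -> R) (a b : R) :
  dominated K f -> a <= b -> Rabs (intR f - RInt f a b) <= K * (PI - (atan b - atan a)).
Proof.
  intros Hf Hab. pose proof (dominated_K_pos _ _ Hf) as HK.
  set (S := fun n => RInt f (- INR n) (INR n)).
  assert (Hex : ex_finite_lim_seq S).
  { apply ex_lim_seq_cauchy_corr. intros eps.
    destruct (atan_tail (eps / (K + 1))) as [M [HM HT]].
    { apply Rdiv_lt_0_compat; [apply eps|lra]. }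
    destruct (archimed_cor1 (/ M)) as [N [HN1 HN2]]. { now apply Rinv_0_lt_compat. }
    assert (HN : M <= INR N).
    { left. apply Rinv_lt_cancel; [now apply lt_0_INR|exact HN1]. }
    assert (Hw : forall n m, (N <= n)%nat -> (n <= m)%nat -> Rabs (S m - S n) < eps).
    { intros n m Hn Hm. apply le_INR in Hn, Hm.
      eapply Rle_lt_trans. unfold S. apply (RInt_dominated_nested K); auto; lra.
      rewrite atan_opp. specialize (HT (INR n) ltac:(lra)).
      assert (eps / (K + 1) * (K + 1) = eps) by (field; lra).
      pose proof (cond_pos eps). nra. }
    exists N. intros n m Hn Hm. destruct (Nat.le_ge_cases n m).
    rewrite Rabs_minus_sym. now apply Hw. now apply Hw. }
  destruct Hex as [L HL].
  assert (intR f = L) as ->. { unfold intR. fold S. now rewrite (is_lim_seq_unique _ _ HL). }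
  assert (HL' : is_lim_seq (fun n => Rabs (S n - RInt f a b)) (Rabs (L - RInt f a b))).
  { apply (is_lim_seq_abs _ (Finite (L - RInt f a b))).
    apply (is_lim_seq_minus' _ _ _ _ HL). apply is_lim_seq_const. }
  refine (is_lim_seq_le_loc _ (fun _ => K * (PI - (atan b - atan a))) _ _ _ HL' (is_lim_seq_const _)).
  destruct (nfloor_ex (Rmax (Rabs a) (Rabs b))) as [N HN].
  { eapply Rle_trans; [apply Rabs_pos|apply Rmax_l]. }
  exists (Datatypes.S N). intros n Hn. apply le_INR in Hn. rewrite S_INR in Hn.
  pose proof (Rmax_l (Rabs a) (Rabs b)). pose proof (Rmax_r (Rabs a) (Rabs b)).
  pose proof (Rle_abs (- a)). rewrite Rabs_Ropp in *. pose proof (Rle_abs b).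
  apply RInt_dominated_nested; auto; lra.
Qed.

Lemma intR_tail_sym (K : R) (f : R -> R) (T : R) :
  dominated K f -> 0 <= T -> Rabs (intR f - RInt f (- T) T) <= K * (PI - 2 * atan T).
Proof.
  intros Hf HT. pose proof (intR_tail K f (- T) T Hf ltac:(lra)) as H.
  rewrite atan_opp in H. replace (2 * atan T) with (atan T - - atan T) by ring. exact H.
Qed.

Lemma intR_approx (K : R) (f : R -> R) (eta : R) : dominated K f -> 0 < eta ->
  exists M, 0 < M /\ forall a b, a <= - M -> M <= b -> Rabs (intR f - RInt f a b) < eta.
Proof.
  intros Hf He. pose proof (dominated_K_pos _ _ Hf) as HK.
  destruct (atan_tail (eta / (K + 1))) as [M [HM HT]].
  { apply Rdiv_lt_0_compat; lra. }
  exists M. split; auto. intros a b Ha Hb.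
  eapply Rle_lt_trans; [apply (intR_tail K); auto; lra|].
  pose proof (HT b Hb). pose proof (HT (- a) ltac:(lra)) as H'. rewrite atan_opp in H'.
  assert (eta / (K + 1) * (K + 1) = eta) by (field; lra). nra.
Qed.

Lemma intR_unique (K : R) (f : R -> R) (l : R) : dominated K f ->
  (forall eta, 0 < eta -> exists M, forall T, M <= T -> Rabs (RInt f (- T) T - l) <= eta) ->
  intR f = l.
Proof.
  intros Hf H. apply cond_eq. intros eps He.
  destruct (intR_approx K f (eps / 2) Hf) as [M1 [HM1 H1]]; [lra|].
  destruct (H (eps / 3)) as [M2 H2]; [lra|].
  set (T := Rmax M1 M2). pose proof (Rmax_l M1 M2). pose proof (Rmax_r M1 M2). fold T in H0, H3.
  specialize (H1 (- T) T ltac:(lra) ltac:(lra)). specialize (H2 T H3).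
  replace (intR f - l) with ((intR f - RInt f (- T) T) + (RInt f (- T) T - l)) by ring.
  eapply Rle_lt_trans; [apply Rabs_triang|]. lra.
Qed.

Lemma is_RInt_gen_intR (K : R) (f : R -> R) : dominated K f ->
  is_RInt_gen f (Rbar_locally m_infty) (Rbar_locally p_infty) (intR f).
Proof.
  intros Hf P [eps HP]. destruct (intR_approx K f eps Hf) as [M [HM H]]; [apply eps|].
  exists (fun a => a < - M) (fun b => M < b); [now exists (- M)|now exists M|].
  intros a b Ha Hb. exists (RInt f a b). split.
  - apply (RInt_correct (V := R_CompleteNormedModule)), ex_RInt_cont, Hf.
  - apply HP. apply (norm_compat1 (V := R_NormedModule)).
    change (Rabs (RInt f a b - intR f) < eps). rewrite Rabs_minus_sym. apply H; lra.
Qed.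

Lemma intR_ext (f g : R -> R) : (forall x, f x = g x) -> intR f = intR g.
Proof.
  intros H. unfold intR. f_equal. apply Lim_seq_ext. intros n. apply RInt_ext. auto.
Qed.

Lemma dominated_ext (K : R) (f g : R -> R) : (forall x, f x = g x) -> dominated K f -> dominated K g.
Proof.
  intros H [H1 H2]. split; intros x.
  - eapply continuous_ext; [exact H|auto].
  - rewrite <- H. auto.
Qed.

Lemma dominated_plus (K L : R) (f g : R -> R) :
  dominated K f -> dominated L g -> dominated (K + L) (fun x => f x + g x).
Proof.
  intros [H1 H2] [H3 H4]. split; intros x.
  - apply (continuous_plus (V := R_NormedModule)); auto.
  - eapply Rle_trans; [apply Rabs_triang|]. specialize (H2 x). specialize (H4 x). lra.
Qed.

Lemma dominated_scal (K k : R) (f : R -> R) : dominated K f -> dominated (Rabs k * K) (fun x => k * f x).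
Proof.
  intros [H1 H2]. split; intros x.
  - apply (continuous_scal_r (V := R_NormedModule)); auto.
  - rewrite Rabs_mult, Rmult_assoc. apply Rmult_le_compat_l; [apply Rabs_pos|auto].
Qed.

Lemma dominated_weaken (K L : R) (f : R -> R) : K <= L -> dominated K f -> dominated L f.
Proof.
  intros H [H1 H2]. split; auto. intros x. eapply Rle_trans; [apply H2|].
  pose proof (cauchy_pos x). nra.
Qed.

(** By uniqueness of [is_RInt_gen], linearity and the fundamental theorem carry over to [intR]. *)
Lemma intR_of_gen (K : R) (f : R -> R) (l : R) : dominated K f ->
  is_RInt_gen f (Rbar_locally m_infty) (Rbar_locally p_infty) l -> intR f = l.
Proof.
  intros Hf H. rewrite <- (is_RInt_gen_unique (V := R_CompleteNormedModule) _ _ H).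
  symmetry. apply (is_RInt_gen_unique (V := R_CompleteNormedModule)). now apply (is_RInt_gen_intR K).
Qed.

Lemma intR_plus (K L : R) (f g : R -> R) : dominated K f -> dominated L g ->
  intR (fun x => f x + g x) = intR f + intR g.
Proof.
  intros Hf Hg. apply (intR_of_gen (K + L)); [now apply dominated_plus|].
  apply (is_RInt_gen_plus (V := R_NormedModule)); eapply is_RInt_gen_intR; eauto.
Qed.

Lemma intR_scal (K k : R) (f : R -> R) : dominated K f -> intR (fun x => k * f x) = k * intR f.
Proof.
  intros Hf. apply (intR_of_gen (Rabs k * K)); [now apply dominated_scal|].
  apply (is_RInt_gen_scal (V := R_NormedModule)); eapply is_RInt_gen_intR; eauto.
Qed.

Lemma intR_comp_lin (K L s w : R) (f : R -> R) : 0 < s -> dominated K f ->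
  dominated L (fun x => s * f (s * x + w)) ->
  intR (fun x => s * f (s * x + w)) = intR f.
Proof.
  intros Hs Hf Hg. apply (intR_unique L); auto. intros eta He.
  destruct (intR_approx K f eta Hf He) as [M [HM H]].
  (* The window [[-T, T]] becomes [[w - s T, w + s T]], off centre by [w]; this is why [intR_approx]
     admits asymmetric ends. *)
  exists ((M + Rabs w) / s). intros T HT.
  assert (M + Rabs w <= s * T).
  { apply (Rmult_le_compat_l s) in HT; [|lra].
    replace (s * ((M + Rabs w) / s)) with (M + Rabs w) in HT by (field; lra). lra. }
  pose proof (Rle_abs w). pose proof (Rle_abs (- w)). rewrite Rabs_Ropp in *.
  assert (E : RInt (fun x => s * f (s * x + w)) (- T) T = RInt f (s * - T + w) (s * T + w)).
  { apply (RInt_comp_lin (V := R_CompleteNormedModule)). apply ex_RInt_cont, Hf. }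
  rewrite E, Rabs_minus_sym. left. apply H; lra.
Qed.

Lemma intR_le (K : R) (f : R -> R) : dominated K f -> Rabs (intR f) <= K * PI.
Proof.
  intros Hf. pose proof (intR_tail K f 0 0 Hf (Rle_refl 0)) as H.
  rewrite RInt_point in H. unfold zero in H; simpl in H. rewrite Rminus_0_r in H.
  replace (PI - (atan 0 - atan 0)) with PI in H by ring. exact H.
Qed.

Lemma intR_derive (K : R) (F f : R -> R) : dominated K f ->
  (forall x, is_derive F x (f x)) ->
  is_lim F m_infty 0 -> is_lim F p_infty 0 -> intR f = 0.
Proof.
  intros Hf HF Hm Hp. apply (intR_of_gen K); auto.
  assert (HD : forall x, Derive F x = f x) by (intros x; now apply is_derive_unique).
  replace 0 with (0 - 0) by ring.
  apply (is_RInt_gen_ext (V := R_NormedModule) (Derive F)).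
  { apply filter_forall. intros ab x _. apply HD. }
  apply is_RInt_gen_Derive; auto; apply filter_forall; intros ab x _.
  - exists (f x). apply HF.
  - apply (continuous_ext f); [now intros; rewrite HD|apply Hf].
Qed.

(** Dominated convergence with locally uniform convergence: the common majorant makes the tails of
    [fn n] and [f] small uniformly in [n], and the window contributes at most its length times the
    distance there. Each of the three pieces gets [eps / 3]. *)
Lemma intR_dominated (K : R) (fn : nat -> R -> R) (f : R -> R) :
  (forall n, dominated K (fn n)) -> dominated K f ->
  (forall T eta, 0 < T -> 0 < eta -> eventually (fun n => forall x, Rabs x <= T -> Rabs (fn n x - f x) <= eta)) ->
  is_lim_seq (fun n => intR (fn n)) (intR f).
Proof.
  intros Hn Hf H. pose proof (dominated_K_pos _ _ Hf) as HK. apply is_lim_seq_spec. intros eps.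
  pose proof (cond_pos eps) as He.
  destruct (atan_tail (eps / (3 * (K + 1)))) as [T [HT HT']].
  { apply Rdiv_lt_0_compat; lra. }
  specialize (HT' T (Rle_refl T)).
  assert (HKT : K * (PI - 2 * atan T) < eps / 3).
  { assert (eps / (3 * (K + 1)) * (K + 1) = eps / 3) by (field; lra). nra. }
  assert (He2 : 0 < eps / (6 * (T + 1))) by (apply Rdiv_lt_0_compat; lra).
  destruct (H T _ HT He2) as [N HN]. exists N. intros n Hge. specialize (HN n Hge).
  pose proof (intR_tail_sym K f T Hf ltac:(lra)) as B1.
  pose proof (intR_tail_sym K (fn n) T (Hn n) ltac:(lra)) as B2.
  assert (B3 : Rabs (RInt (fn n) (- T) T - RInt f (- T) T) <= (T - - T) * (eps / (6 * (T + 1)))).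
  { change (norm (minus (RInt (fn n) (- T) T) (RInt f (- T) T)) <= (T - - T) * (eps / (6 * (T + 1)))).
    apply (norm_RInt_le_const (V := R_NormedModule) (fun x => minus (fn n x) (f x))); [lra| |].
    - intros x Hx. apply HN. apply Rabs_le. lra.
    - apply (is_RInt_minus (V := R_NormedModule));
      apply (RInt_correct (V := R_CompleteNormedModule)); apply ex_RInt_cont; [apply Hn|apply Hf]. }
  assert (B4 : (T - - T) * (eps / (6 * (T + 1))) < eps / 3).
  { replace (eps / 3) with ((2 * (T + 1)) * (eps / (6 * (T + 1)))) by (field; lra).
    apply Rmult_lt_compat_r; lra. }
  replace (intR (fn n) - intR f) with ((intR (fn n) - RInt (fn n) (- T) T)
     + (RInt (fn n) (- T) T - RInt f (- T) T) - (intR f - RInt f (- T) T)) by ring.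
  eapply Rle_lt_trans; [apply Rabs_triang|]. rewrite Rabs_Ropp.
  eapply Rle_lt_trans; [apply Rplus_le_compat_r, Rabs_triang|]. lra.
Qed.

(** * Fubini *)

Definition cont2 (F : R -> R -> R) : Prop := forall x y, continuity_2d_pt F x y.

Lemma cont2_l (F : R -> R -> R) (y x : R) : cont2 F -> continuous (fun x => F x y) x.
Proof.
  intros H. apply continuity_pt_filterlim. intros eps He.
  destruct (H x y (mkposreal _ He)) as [d Hd]. exists d. split; [apply d|].
  intros x' [_ Hx']. apply Hd; [exact Hx'|]. rewrite Rminus_diag, Rabs_R0. apply d.
Qed.

Lemma cont2_swap (F : R -> R -> R) : cont2 F -> cont2 (fun x y => F y x).
Proof.
  intros H x y eps. destruct (H y x eps) as [d Hd]. exists d. intros u v Hu Hv. now apply Hd.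
Qed.

Lemma cont2_r (F : R -> R -> R) (x y : R) : cont2 F -> continuous (F x) y.
Proof. intros H. now apply (cont2_l (fun y x => F x y)), cont2_swap. Qed.

Lemma RInt_param_continuous (F : R -> R -> R) (a b x : R) : cont2 F -> a <= b ->
  continuous (fun x => RInt (F x) a b) x.
Proof.
  intros H Hab. apply continuity_pt_filterlim. intros eps He.
  assert (He' : 0 < eps / (2 * (b - a + 1))) by (apply Rdiv_lt_0_compat; lra).
  destruct (uniform_continuity_2d_1d' F a b x (fun y _ => H x y) (mkposreal _ He')) as [d Hd].
  exists d. split; [apply d|]. intros x' [_ Hx'].
  change (Rabs (x' - x) < d) in Hx'. apply Rabs_def2 in Hx'.
  change (norm (minus (RInt (F x') a b) (RInt (F x) a b)) < eps).
  apply Rle_lt_trans with ((b - a) * (eps / (2 * (b - a + 1)))).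
  - apply (norm_RInt_le_const (V := R_NormedModule) (fun y => minus (F x' y) (F x y))); auto.
    + intros y Hy. left. pose proof (cond_pos d). apply Hd; try lra. rewrite Rminus_diag, Rabs_R0; lra.
    + apply (is_RInt_minus (V := R_NormedModule));
      apply (RInt_correct (V := R_CompleteNormedModule)); apply ex_RInt_cont; intros y; now apply cont2_r.
  - assert (E : eps = 2 * (b - a + 1) * (eps / (2 * (b - a + 1)))) by (field; lra).
    rewrite E at 2. apply Rmult_lt_compat_r; lra.
Qed.

Lemma is_derive_RInt_upper (f : R -> R) (a x : R) : (forall x, continuous f x) ->
  is_derive (RInt f a) x (f x).
Proof.
  intros H. apply (is_derive_RInt (V := R_CompleteNormedModule) f _ a); [|auto].
  apply filter_forall. intros y. apply (RInt_correct (V := R_CompleteNormedModule)). now apply ex_RInt_cont.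
Qed.

(** As functions of the upper end [b], both sides have the same derivative and vanish at [b = a]; on
    the right the derivative is taken under the integral sign. *)
Lemma RInt_Fubini (F : R -> R -> R) (a b c d : R) : cont2 F -> a <= b -> c <= d ->
  RInt (fun x => RInt (F x) c d) a b = RInt (fun y => RInt (fun x => F x y) a b) c d.
Proof.
  intros H Hab Hcd.
  assert (Hc : forall x, continuous (fun x => RInt (F x) c d) x) by (intros; now apply RInt_param_continuous).
  assert (HD : forall x y, Derive (fun z => RInt (fun u => F u y) a z) x = F x y).
  { intros. apply is_derive_unique, (is_derive_RInt_upper (fun u => F u y)). intros. now apply cont2_l. }
  set (G := fun t => RInt (fun y => RInt (fun x => F x y) a t) c d).
  assert (HG : forall t, a <= t <= b -> is_derive G t (RInt (F t) c d)).
  { intros t _.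
    rewrite <- (RInt_ext (fun y => Derive (fun z => RInt (fun u => F u y) a z) t)) by (intros; apply HD).
    apply (is_derive_RInt_param (fun t y => RInt (fun x => F x y) a t)).
    - apply filter_forall. intros t' y _. eexists. apply (is_derive_RInt_upper (fun u => F u y)).
      intros. now apply cont2_l.
    - intros y _. eapply continuity_2d_pt_ext; [intros; symmetry; apply HD|]. apply H.
    - apply filter_forall. intros t'. apply ex_RInt_cont. intros y.
      destruct (Rle_dec a t').
      + apply (RInt_param_continuous (fun y x => F x y)); auto. now apply cont2_swap.
      (* The parametric derivative is two-sided, so [t'] may lie below [a]; the interval is then
         reversed. *)
      + apply (continuous_ext (fun y => opp (RInt (fun x => F x y) t' a))).
        { intros. apply (opp_RInt_swap (V := R_CompleteNormedModule)). apply ex_RInt_cont. intros. now apply cont2_l. }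
        apply (continuous_opp (V := R_NormedModule)), (RInt_param_continuous (fun y x => F x y)); try lra.
        now apply cont2_swap. }
  assert (E : is_RInt (fun x => RInt (F x) c d) a b (minus (G b) (G a))).
  { apply (is_RInt_derive (V := R_CompleteNormedModule)).
    - rewrite Rmin_left, Rmax_right by auto. exact HG.
    - auto. }
  apply (is_RInt_unique (V := R_CompleteNormedModule)) in E. rewrite E.
  assert (G a = 0) as ->.
  { unfold G. rewrite (RInt_ext _ (fun _ => 0)). rewrite RInt_const. unfold scal; simpl. unfold mult; simpl. ring.
    intros. apply (RInt_point (V := R_CompleteNormedModule)). }
  unfold minus, plus, opp; simpl. unfold G. ring.
Qed.

Lemma intR_param_continuous (F : R -> R -> R) (K : R) : cont2 F -> (forall x, dominated K (F x)) ->
  forall x, continuous (fun x => intR (F x)) x.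
Proof.
  intros H HK x. pose proof (dominated_K_pos _ _ (HK x)) as HK0.
  apply continuity_pt_filterlim. intros eps He.
  destruct (atan_tail (eps / (3 * (K + 1)))) as [T [HT HT']].
  { apply Rdiv_lt_0_compat; lra. }
  specialize (HT' T (Rle_refl T)).
  assert (HKT : K * (PI - 2 * atan T) < eps / 3).
  { assert (eps / (3 * (K + 1)) * (K + 1) = eps / 3) by (field; lra). nra. }
  pose proof (RInt_param_continuous F (- T) T x H ltac:(lra)) as C.
  apply continuity_pt_filterlim in C. destruct (C (eps / 3) ltac:(lra)) as [d [Hd Hx]].
  exists d. split; auto. intros x' Hx'. specialize (Hx x' Hx'). simpl in *. unfold Rdist in *.
  pose proof (intR_tail_sym K (F x) T (HK x) ltac:(lra)).
  pose proof (intR_tail_sym K (F x') T (HK x') ltac:(lra)).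
  replace (intR (F x') - intR (F x)) with ((intR (F x') - RInt (F x') (- T) T)
     + (RInt (F x') (- T) T - RInt (F x) (- T) T) - (intR (F x) - RInt (F x) (- T) T)) by ring.
  eapply Rle_lt_trans; [apply Rabs_triang|]. rewrite Rabs_Ropp.
  eapply Rle_lt_trans; [apply Rplus_le_compat_r, Rabs_triang|]. lra.
Qed.

(** With a product majorant, every slice and every partial integral is dominated again. *)
Definition dominated2 (K : R) (F : R -> R -> R) : Prop :=
  cont2 F /\ forall x y, Rabs (F x y) <= K * / (1 + x ^ 2) * / (1 + y ^ 2).

Lemma dominated2_swap (K : R) (F : R -> R -> R) : dominated2 K F -> dominated2 K (fun x y => F y x).
Proof.
  intros [H1 H2]. split; [now apply cont2_swap|]. intros x y. specialize (H2 y x). lra.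
Qed.

Lemma dominated2_slice (K : R) (F : R -> R -> R) (x : R) : dominated2 K F -> dominated (K * / (1 + x ^ 2)) (F x).
Proof. intros [H1 H2]. split; [intros; now apply cont2_r|apply H2]. Qed.

Lemma dominated2_intR (K : R) (F : R -> R -> R) : dominated2 K F -> dominated (K * PI) (fun x => intR (F x)).
Proof.
  intros HF. split.
  - apply (intR_param_continuous F K); [apply HF|]. intros x.
    apply (dominated_weaken (K * / (1 + x ^ 2))); [|now apply dominated2_slice].
    assert (0 <= K).
    { destruct HF as [_ H]. specialize (H 0 0). pose proof (Rabs_pos (F 0 0)).
      replace (/ (1 + 0 ^ 2)) with 1 in H by field. lra. }
    pose proof (cauchy_pos x). assert (/ (1 + x ^ 2) <= 1); [|nra].
    rewrite <- Rinv_1. apply Rinv_le_contravar; nra.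
  - intros x. pose proof (intR_le _ _ (dominated2_slice K F x HF)). lra.
Qed.

(** The outer tail costs [K * PI * (PI - 2 * atan T)]; the inner tails, integrated over the window,
    cost at most the same again, hence the factor 2. *)
Lemma dominated2_rect (K : R) (F : R -> R -> R) (T : R) : dominated2 K F -> 0 <= T ->
  Rabs (intR (fun x => intR (F x)) - RInt (fun x => RInt (F x) (- T) T) (- T) T)
   <= 2 * K * PI * (PI - 2 * atan T).
Proof.
  intros HF HT. pose proof (dominated2_intR K F HF) as HG.
  pose proof (intR_tail_sym _ _ T HG HT) as B1.
  assert (B2 : Rabs (RInt (fun x => intR (F x)) (- T) T - RInt (fun x => RInt (F x) (- T) T) (- T) T) <=
      (K * (PI - 2 * atan T)) * (atan T - atan (- T))).
  { change (norm (minus (RInt (fun x => intR (F x)) (- T) T) (RInt (fun x => RInt (F x) (- T) T) (- T) T)) <=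
      (K * (PI - 2 * atan T)) * (atan T - atan (- T))).
    apply (norm_RInt_le (V := R_NormedModule) (fun x => minus (intR (F x)) (RInt (F x) (- T) T))
      (fun x => K * (PI - 2 * atan T) * / (1 + x ^ 2)) (- T) T); [lra| | |].
    - intros x _. pose proof (intR_tail_sym _ _ T (dominated2_slice K F x HF) HT).
      change (Rabs (intR (F x) - RInt (F x) (- T) T) <= K * (PI - 2 * atan T) * / (1 + x ^ 2)). lra.
    - apply (is_RInt_minus (V := R_NormedModule));
      apply (RInt_correct (V := R_CompleteNormedModule)); apply ex_RInt_cont; intros y; [apply HG|].
      apply RInt_param_continuous; [apply HF|lra].
    - apply (is_RInt_scal (V := R_NormedModule)), is_RInt_cauchy. }
  replace (intR (fun x => intR (F x)) - RInt (fun x => RInt (F x) (- T) T) (- T) T) with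
    ((intR (fun x => intR (F x)) - RInt (fun x => intR (F x)) (- T) T) +
     (RInt (fun x => intR (F x)) (- T) T - RInt (fun x => RInt (F x) (- T) T) (- T) T)) by ring.
  eapply Rle_trans; [apply Rabs_triang|].
  rewrite atan_opp in B2. pose proof (atan_bound T).
  assert (0 <= K).
  { pose proof (dominated_K_pos _ _ HG). pose proof PI_RGT_0. nra. }
  assert (0 <= K * (PI - 2 * atan T)) by nra. nra.
Qed.

(** Both iterated integrals are close to the same integral over a square, where [RInt_Fubini]
    applies. *)
Lemma intR_Fubini (K : R) (F : R -> R -> R) : dominated2 K F ->
  intR (fun x => intR (F x)) = intR (fun y => intR (fun x => F x y)).
Proof.
  intros HF. pose proof (dominated2_swap K F HF) as HS. apply cond_eq. intros eps He.
  pose proof (dominated_K_pos _ _ (dominated2_intR K F HF)) as HK. pose proof PI_RGT_0.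
  destruct (atan_tail (eps / (4 * (K * PI + 1)))) as [T [HT HT']].
  { apply Rdiv_lt_0_compat; lra. }
  specialize (HT' T (Rle_refl T)).
  pose proof (dominated2_rect K _ T HF ltac:(lra)) as B1.
  pose proof (dominated2_rect K _ T HS ltac:(lra)) as B2.
  assert (B3 : Rabs (RInt (fun x => RInt (F x) (- T) T) (- T) T - intR (fun y => intR (fun x => F x y)))
     <= 2 * K * PI * (PI - 2 * atan T)).
  { rewrite (RInt_Fubini F (- T) T (- T) T), Rabs_minus_sym by (try apply HF; lra). exact B2. }
  match goal with |- Rabs (?a - ?b) < _ =>
    replace (a - b) with ((a - RInt (fun x => RInt (F x) (- T) T) (- T) T) + (RInt (fun x => RInt (F x) (- T) T) (- T) T - b)) by ring end.
  eapply Rle_lt_trans; [apply Rabs_triang|].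
  assert (eps / (4 * (K * PI + 1)) * (4 * (K * PI + 1)) = eps) by (field; lra). nra.
Qed.

(** * Complex integrands *)

Lemma dominated_lim (K : R) (f : R -> R) : dominated K f -> is_lim f m_infty 0 /\ is_lim f p_infty 0.
Proof.
  intros Hf. pose proof (dominated_K_pos _ _ Hf) as HK. destruct Hf as [_ H].
  assert (Hm : forall eps : posreal, forall x, K / eps + 1 < Rabs x -> Rabs (f x - 0) < eps).
  { intros eps x Hx. rewrite Rminus_0_r. pose proof (cond_pos eps).
    eapply Rle_lt_trans; [apply H|]. pose proof (cauchy_pos x).
    apply (Rmult_lt_reg_r (1 + x ^ 2)); [nra|].
    rewrite Rmult_assoc, Rinv_l by nra. rewrite Rmult_1_r, <- (pow2_abs x).
    assert (0 <= K / eps) by (apply Rdiv_le_0_compat; lra).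
    assert (cexp : K = K / eps * eps) by (field; lra).
    rewrite cexp at 1. rewrite (Rmult_comm eps). apply Rmult_lt_compat_r; nra. }
  split; apply is_lim_spec; intros eps;
    assert (0 <= K / eps) by (apply Rdiv_le_0_compat; [lra|apply cond_pos]).
  - exists (- (K / eps + 1)). intros x Hx. apply Hm. rewrite Rabs_left; lra.
  - exists (K / eps + 1). intros x Hx. apply Hm. rewrite Rabs_right; lra.
Qed.

Lemma dominated_comp_lin (K s w : R) (f : R -> R) : 0 < s -> dominated K f ->
  exists L, dominated L (fun x => f (s * x + w)).
Proof.
  intros Hs Hf. pose proof (dominated_K_pos _ _ Hf) as HK. destruct Hf as [H1 H2].
  (* With [x = (y - w) / s], the inequality [(y - w)^2 <= 2 y^2 + 2 w^2] bounds [1 + x^2] by this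
     factor times [1 + y^2]. *)
  exists (K * (1 + 2 / s ^ 2 + 2 * w ^ 2 / s ^ 2)). split; intros x.
  - apply (continuous_comp (fun x => s * x + w) f); [|auto].
    apply (ex_derive_continuous (V := R_NormedModule)). now auto_derive.
  - eapply Rle_trans; [apply H2|]. rewrite Rmult_assoc. apply Rmult_le_compat_l; auto.
    set (y := s * x + w). assert (Ey : x = (y - w) / s) by (unfold y; field; lra).
    apply (Rmult_le_reg_l (1 + y ^ 2)); [nra|]. rewrite Rinv_r by nra.
    apply (Rmult_le_reg_r (1 + x ^ 2)); [nra|]. rewrite Rmult_1_l.
    replace (_ * _ * _) with ((1 + y ^ 2) * (1 + 2 / s ^ 2 + 2 * w ^ 2 / s ^ 2)) by (field; nra).
    set (r := / s). assert (0 < r) by (now apply Rinv_0_lt_compat).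
    replace (2 / s ^ 2) with (2 * r ^ 2) by (unfold r; field; lra).
    replace (2 * w ^ 2 / s ^ 2) with (2 * w ^ 2 * r ^ 2) by (unfold r; field; lra).
    replace x with ((y - w) * r) by (rewrite Ey; unfold r; field; lra).
    assert ((y - w) ^ 2 <= 2 * y ^ 2 + 2 * w ^ 2) by (pose proof (pow2_ge_0 (y + w)); nra).
    assert (((y - w) * r) ^ 2 <= (2 * y ^ 2 + 2 * w ^ 2) * r ^ 2).
    { replace (((y - w) * r) ^ 2) with ((y - w) ^ 2 * r ^ 2) by ring.
      apply Rmult_le_compat_r; nra. }
    assert (0 <= r ^ 2) by nra. assert (0 <= y ^ 2 * (2 * w ^ 2 * r ^ 2)).
    { apply Rmult_le_pos; nra. }
    nra.
Qed.

Definition intC (f : R -> C) : C := (intR (fun x => Re (f x)), intR (fun x => Im (f x))).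

Definition Cdominated (f : R -> C) : Prop :=
  exists K, dominated K (fun x => Re (f x)) /\ dominated K (fun x => Im (f x)).

Lemma Cdominated_intro (K L : R) (f : R -> C) :
  dominated K (fun x => Re (f x)) -> dominated L (fun x => Im (f x)) -> Cdominated f.
Proof.
  intros H1 H2. exists (Rmax K L). split.
  - now apply (dominated_weaken K); [apply Rmax_l|].
  - now apply (dominated_weaken L); [apply Rmax_r|].
Qed.

Lemma intC_ext (f g : R -> C) : (forall x, f x = g x) -> intC f = intC g.
Proof. intros H. unfold intC. f_equal; apply intR_ext; intros; now rewrite H. Qed.

Lemma Cdominated_ext (f g : R -> C) : (forall x, f x = g x) -> Cdominated f -> Cdominated g.
Proof.
  intros H [K [H1 H2]]. exists K. split.
  - apply (dominated_ext _ (fun x => Re (f x))); auto. intros; now rewrite H.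
  - apply (dominated_ext _ (fun x => Im (f x))); auto. intros; now rewrite H.
Qed.

Lemma Cdominated_cmult (c : C) (f : R -> C) : Cdominated f -> Cdominated (fun x => Cmult c (f x)).
Proof.
  intros [K [H1 H2]].
  eapply Cdominated_intro.
  - eapply (dominated_ext _ (fun x => Re c * Re (f x) + (- Im c) * Im (f x))).
    + intros. simpl. unfold Re, Im. ring.
    + apply dominated_plus; apply dominated_scal; eassumption.
  - eapply (dominated_ext _ (fun x => Re c * Im (f x) + Im c * Re (f x))).
    + intros. simpl. unfold Re, Im. ring.
    + apply dominated_plus; apply dominated_scal; eassumption.
Qed.

Lemma intC_cmult (c : C) (f : R -> C) : Cdominated f -> intC (fun x => Cmult c (f x)) = Cmult c (intC f).
Proof.
  intros [K [H1 H2]]. unfold intC. apply injective_projections; simpl.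
  - rewrite (intR_ext _ (fun x => Re c * Re (f x) + (- Im c) * Im (f x))) by (intros; unfold Re, Im; ring).
    erewrite intR_plus by (eapply dominated_scal; eassumption).
    erewrite !intR_scal by eassumption. unfold Re, Im; ring.
  - rewrite (intR_ext _ (fun x => Re c * Im (f x) + Im c * Re (f x))) by (intros; unfold Re, Im; ring).
    erewrite intR_plus by (eapply dominated_scal; eassumption).
    erewrite !intR_scal by eassumption. unfold Re, Im; ring.
Qed.

Lemma Cdominated_plus (f g : R -> C) : Cdominated f -> Cdominated g -> Cdominated (fun x => Cplus (f x) (g x)).
Proof.
  intros [K [H1 H2]] [L [H3 H4]]. exists (K + L). split; simpl.
  - exact (dominated_plus _ _ _ _ H1 H3).
  - exact (dominated_plus _ _ _ _ H2 H4).
Qed.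

Lemma intC_plus (f g : R -> C) : Cdominated f -> Cdominated g ->
  intC (fun x => Cplus (f x) (g x)) = Cplus (intC f) (intC g).
Proof.
  intros [K [H1 H2]] [L [H3 H4]]. unfold intC, Cplus; simpl.
  f_equal; [apply (intR_plus _ _ _ _ H1 H3)|apply (intR_plus _ _ _ _ H2 H4)].
Qed.

Lemma Cdominated_comp_lin (s w : R) (f : R -> C) : 0 < s -> Cdominated f ->
  Cdominated (fun x => f (s * x + w)).
Proof.
  intros Hs [K [H1 H2]]. destruct (dominated_comp_lin _ s w _ Hs H1) as [L1 G1].
  destruct (dominated_comp_lin _ s w _ Hs H2) as [L2 G2]. now apply (Cdominated_intro L1 L2).
Qed.

Lemma intC_comp_lin (s w : R) (f : R -> C) : 0 < s -> Cdominated f ->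
  intC (fun x => Cmult (RtoC s) (f (s * x + w))) = intC f.
Proof.
  intros Hs [K [H1 H2]]. destruct (dominated_comp_lin _ s w _ Hs H1) as [L1 G1].
  destruct (dominated_comp_lin _ s w _ Hs H2) as [L2 G2]. unfold intC; apply injective_projections; simpl.
  - rewrite <- (intR_comp_lin K _ s w _ Hs H1 (dominated_scal _ s _ G1)). apply intR_ext. intros. unfold Re; ring.
  - rewrite <- (intR_comp_lin K _ s w _ Hs H2 (dominated_scal _ s _ G2)). apply intR_ext. intros. unfold Im, Re; ring.
Qed.

Lemma intC_shift (w : R) (f : R -> C) : Cdominated f -> intC (fun x => f (x + w)) = intC f.
Proof.
  intros Hf. rewrite <- (intC_comp_lin 1 w f) by (auto; lra).
  apply intC_ext. intros x. rewrite Rmult_1_l. symmetry. apply Cmult_1_l.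
Qed.

Definition Cdominated2 (F : R -> R -> C) : Prop :=
  exists K, dominated2 K (fun x y => Re (F x y)) /\ dominated2 K (fun x y => Im (F x y)).

Lemma intC_Fubini (F : R -> R -> C) : Cdominated2 F ->
  intC (fun x => intC (F x)) = intC (fun y => intC (fun x => F x y)).
Proof.
  intros [K [H1 H2]]. unfold intC; simpl. f_equal.
  - apply (intR_Fubini K _ H1).
  - apply (intR_Fubini K _ H2).
Qed.

(** * Complex exponentials and convergence strips of Mellin integrals *)

(** [e^(s u)] for real [u], the image of [x^s] under [x = e^u]: [Cpowr x s] is convertible to
    [cexp s (ln x)]. *)
Definition cexp (s : C) (u : R) : C :=
  (exp (Re s * u) * cos (Im s * u), exp (Re s * u) * sin (Im s * u)).

Lemma cexp_plus_r (s : C) (u v : R) : cexp s (u + v) = Cmult (cexp s u) (cexp s v).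
Proof.
  unfold cexp, Cmult; simpl. rewrite !Rmult_plus_distr_l, exp_plus, cos_plus, sin_plus. f_equal; ring.
Qed.

Lemma cexp_plus_l (s t : C) (u : R) : cexp (Cplus s t) u = Cmult (cexp s u) (cexp t u).
Proof.
  unfold cexp, Cmult, Re, Im; simpl. rewrite !Rmult_plus_distr_r, exp_plus, cos_plus, sin_plus. f_equal; ring.
Qed.

Lemma cexp_RtoC (x u : R) : cexp (RtoC x) u = RtoC (exp (x * u)).
Proof. unfold cexp, RtoC; simpl. rewrite Rmult_0_l, cos_0, sin_0. f_equal; ring. Qed.

Lemma Cmod_cexp (s : C) (u : R) : Cmod (cexp s u) = exp (Re s * u).
Proof.
  unfold Cmod, cexp; simpl.
  replace (_ + _) with (Rsqr (exp (Re s * u)) * (Rsqr (sin (Im s * u)) + Rsqr (cos (Im s * u)))) by (unfold Rsqr; ring).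
  rewrite sin2_cos2, Rmult_1_r. apply sqrt_Rsqr. left; apply exp_pos.
Qed.

Lemma exp_le_compat (x y : R) : x <= y -> exp x <= exp y.
Proof. intros [H|H]; [left; now apply exp_increasing|right; now f_equal]. Qed.

Lemma Im_le_Cmod (z : C) : Rabs (Im z) <= Cmod z.
Proof. eapply Rle_trans; [apply Rmax_r|apply Rmax_Cmod]. Qed.

(** Squaring [1 + y / 2 <= exp (y / 2)] gives [1 + y^2 / 4 <= exp y] for [y >= 0]; at
    [y = e * Rabs u] the constant [4 / e^2] undoes the factor [e^2 / 4]. *)
Lemma exp_abs_cauchy (e u : R) : 0 < e -> exp (- e * Rabs u) <= (1 + 4 / e ^ 2) * / (1 + u ^ 2).
Proof.
  intros He. replace (- e * Rabs u) with (- (e * Rabs u)) by ring. rewrite exp_Ropp.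
  pose proof (Rabs_pos u). rewrite <- (pow2_abs u). set (x := Rabs u) in *.
  assert (H1 : 1 + (e * x) ^ 2 / 4 <= exp (e * x)).
  { assert (0 <= e * x) by nra. pose proof (exp_ineq1_le (e * x / 2)).
    replace (e * x) with (e * x / 2 + e * x / 2) at 2 by field. rewrite exp_plus. nra. }
  pose proof (exp_pos (e * x)).
  apply (Rmult_le_reg_l (exp (e * x))); [auto|]. rewrite Rinv_r by lra.
  apply (Rmult_le_reg_r (1 + x ^ 2)); [nra|]. rewrite Rmult_1_l.
  replace (_ * _ * _) with (exp (e * x) * (1 + 4 / e ^ 2)) by (field; nra).
  assert (0 < / e ^ 2) by (apply Rinv_0_lt_compat; nra).
  apply Rle_trans with ((1 + (e * x) ^ 2 / 4) * (1 + 4 / e ^ 2)).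
  - replace ((1 + (e * x) ^ 2 / 4) * (1 + 4 / e ^ 2)) with (1 + x ^ 2 + (e * x) ^ 2 / 4 + 4 * / e ^ 2) by (field; lra).
    nra.
  - apply Rmult_le_compat_r; [unfold Rdiv; nra|auto].
Qed.

Lemma exp_abs_le (a b u y : R) : 0 < a -> 0 < b ->
  y <= exp (a * u) -> y <= exp (- b * u) -> y <= exp (- (Rmin a b) * Rabs u).
Proof.
  intros Ha Hb H1 H2. pose proof (Rmin_l a b). pose proof (Rmin_r a b).
  destruct (Rle_dec 0 u).
  - rewrite Rabs_right by lra. eapply Rle_trans; [exact H2|]. apply exp_le_compat. nra.
  - rewrite Rabs_left by lra. eapply Rle_trans; [exact H1|]. apply exp_le_compat. nra.
Qed.

Lemma exp_cauchy (a b : R) : 0 < a -> 0 < b -> exists K, 0 <= K /\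
  forall u y, y <= exp (a * u) -> y <= exp (- b * u) -> y <= K * / (1 + u ^ 2).
Proof.
  intros Ha Hb. exists (1 + 4 / (Rmin a b) ^ 2).
  assert (0 < Rmin a b) by now apply Rmin_glb_lt.
  split.
  - assert (0 < / Rmin a b ^ 2) by (apply Rinv_0_lt_compat; nra). unfold Rdiv; nra.
  - intros u y H1 H2. eapply Rle_trans; [apply (exp_abs_le a b u); auto|]. now apply exp_abs_cauchy.
Qed.

(** In the variable [x = e^u]: of order [x^a] near 0 and [x^(-b)] near infinity, so the Mellin
    integral converges in the strip [-a < Re s < b]. A negative [b] allows growth at infinity. *)
Definition exp_bounded (A a b : R) (r : R -> R) : Prop :=
  (forall u, continuous r u) /\
  forall u, Rabs (r u) <= A * exp (a * u) /\ Rabs (r u) <= A * exp (- b * u).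

Lemma continuous_exp_cos (a b u : R) : continuous (fun u => exp (a * u) * cos (b * u)) u.
Proof. apply (ex_derive_continuous (V := R_NormedModule)). now auto_derive. Qed.

Lemma continuous_exp_sin (a b u : R) : continuous (fun u => exp (a * u) * sin (b * u)) u.
Proof. apply (ex_derive_continuous (V := R_NormedModule)). now auto_derive. Qed.

(** The constant depends on [s] only through its real part and on [r] only through its bounds. The
    first uniformity serves whole vertical lines, the second the sequence of Gauss kernels. *)
Lemma Cdominated_cexp_uniform (A a b c : R) : 0 < c + a -> 0 < b - c ->
  exists K, forall s r, Re s = c -> exp_bounded A a b r ->
    dominated K (fun u => Re (Cmult (cexp s u) (RtoC (r u)))) /\
    dominated K (fun u => Im (Cmult (cexp s u) (RtoC (r u)))).
Proof.
  intros Ha Hb. destruct (exp_cauchy _ _ Ha Hb) as [K [HK H]].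
  exists (A * K). intros s r <- [Hc Hr].
  assert (HA : 0 <= A).
  { destruct (Hr 0) as [H0 _]. rewrite Rmult_0_r, exp_0 in H0. pose proof (Rabs_pos (r 0)). lra. }
  assert (B : forall u, Cmod (Cmult (cexp s u) (RtoC (r u))) <= A * K * / (1 + u ^ 2)).
  { intros u. rewrite Cmod_mult, Cmod_cexp, Cmod_R. destruct (Hr u) as [H1 H2].
    destruct HA as [HA|HA].
    - assert (exp (Re s * u) * Rabs (r u) * / A <= K * / (1 + u ^ 2)).
      { pose proof (exp_pos (Re s * u)).
        apply H; apply (Rmult_le_reg_r A); auto; rewrite Rmult_assoc, Rinv_l, Rmult_1_r by lra.
        - rewrite Rmult_plus_distr_r, exp_plus. nra.
        - replace (- (b - Re s) * u) with (Re s * u + - b * u) by ring. rewrite exp_plus. nra. }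
      apply (Rmult_le_compat_r A) in H0; [|lra].
      rewrite Rmult_assoc, Rinv_l, Rmult_1_r in H0 by lra. lra.
    - subst A. rewrite Rmult_0_l in H1. pose proof (Rabs_pos (r u)).
      replace (Rabs (r u)) with 0 by lra. lra. }
  split; (split; intros u; [|eapply Rle_trans; [|apply B]]).
  - simpl. apply (continuous_ext (fun u => exp (Re s * u) * cos (Im s * u) * r u)).
    { intros; simpl; unfold Re, Im; ring. }
    apply (continuous_mult (K := R_AbsRing)); auto. apply continuous_exp_cos.
  - apply re_le_Cmod.
  - simpl. apply (continuous_ext (fun u => exp (Re s * u) * sin (Im s * u) * r u)).
    { intros; simpl; unfold Re, Im; ring. }
    apply (continuous_mult (K := R_AbsRing)); auto. apply continuous_exp_sin.
  - apply Im_le_Cmod.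
Qed.

Lemma Cdominated_cexp (A a b : R) (s : C) (r : R -> R) : exp_bounded A a b r ->
  0 < Re s + a -> 0 < b - Re s -> Cdominated (fun u => Cmult (cexp s u) (RtoC (r u))).
Proof.
  intros Hr Ha Hb. destruct (Cdominated_cexp_uniform A a b (Re s) Ha Hb) as [K H]. exists K. now apply H.
Qed.

(** The derivative of [e^(s u) r(u)] integrates to 0: the domination that makes the left integral
    converge also makes the boundary terms vanish ([dominated_lim]). *)
Lemma intC_by_parts (A a b A' a' b' : R) (s : C) (r dr : R -> R) :
  exp_bounded A a b r -> 0 < Re s + a -> 0 < b - Re s ->
  exp_bounded A' a' b' dr -> 0 < Re s + a' -> 0 < b' - Re s ->
  (forall u, is_derive r u (dr u)) ->
  Cmult s (intC (fun u => Cmult (cexp s u) (RtoC (r u)))) = Copp (intC (fun u => Cmult (cexp s u) (RtoC (dr u)))).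
Proof.
  intros H1 H2 H3 H4 H5 H6 Hd.
  pose proof (Cdominated_cexp _ _ _ _ _ H1 H2 H3) as G. pose proof (Cdominated_cexp _ _ _ _ _ H4 H5 H6) as G'.
  pose proof (Cdominated_cmult s _ G) as Gs. rewrite <- intC_cmult by auto.
  assert (Hex : forall u, ex_derive r u) by (intros; eexists; apply Hd).
  assert (HD : forall u, Derive (fun x => r x) u = dr u) by (intros; now apply is_derive_unique).
  assert (Z : Cplus (intC (fun u => Cmult s (Cmult (cexp s u) (RtoC (r u))))) (intC (fun u => Cmult (cexp s u) (RtoC (dr u)))) = RtoC 0).
  { rewrite <- intC_plus by auto. pose proof (Cdominated_plus _ _ Gs G') as [K [K1 K2]].
    destruct G as [L [L1 L2]]. unfold intC. unfold RtoC; f_equal.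
    - destruct (dominated_lim _ _ L1). apply (intR_derive K (fun u => Re (Cmult (cexp s u) (RtoC (r u))))); auto.
      intros u. simpl. unfold Re, Im; simpl. auto_derive; [auto|]. rewrite HD. simpl. ring.
    - destruct (dominated_lim _ _ L2). apply (intR_derive K (fun u => Im (Cmult (cexp s u) (RtoC (r u))))); auto.
      intros u. simpl. unfold Re, Im; simpl. auto_derive; [auto|]. rewrite HD. simpl. ring. }
  apply (f_equal (fun z => Cplus z (Copp (intC (fun u => Cmult (cexp s u) (RtoC (dr u))))))) in Z.
  rewrite <- Cplus_assoc, Cplus_opp_r, Cplus_0_r, Cplus_0_l in Z. exact Z.
Qed.

(** * Gauss' limit as Euler's integral *)

(** For [u >= 0], combine [exp u >= u^2 / 4] with [(u / 2 - B)^2 >= 0]. It makes [exp (- exp u)]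
    decay faster than every [e^(-B u)], at the price of the constant [exp (B^2)]. *)
Lemma exp_exp_ge (B u : R) : 0 <= B -> B * u - B ^ 2 <= exp u.
Proof.
  intros HB. pose proof (exp_pos u). destruct (Rle_dec 0 u); [|nra].
  pose proof (exp_ineq1_le (u / 2)).
  assert (exp u = exp (u / 2) * exp (u / 2)) as -> by (rewrite <- exp_plus; f_equal; field).
  pose proof (pow2_ge_0 (u / 2 - B)). nra.
Qed.

Lemma exp_bounded_le (A a b : R) (r r' : R -> R) : (forall u, continuous r' u) ->
  (forall u, Rabs (r' u) <= Rabs (r u)) -> exp_bounded A a b r -> exp_bounded A a b r'.
Proof.
  intros Hc Hle [_ H]. split; auto. intros u. destruct (H u). specialize (Hle u). lra.
Qed.

Lemma exp_bounded_exp_exp (B : R) : 0 <= B -> exp_bounded (exp (B ^ 2)) 0 B (fun u => exp (- exp u)).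
Proof.
  intros HB. split.
  - intros u. apply (ex_derive_continuous (V := R_NormedModule)). now auto_derive.
  - intros u. rewrite Rabs_right by (left; apply exp_pos). rewrite <- !exp_plus.
    pose proof (exp_pos u). pose proof (exp_exp_ge B u HB).
    split; apply exp_le_compat; nra.
Qed.

(** Euler's integral of [x^(s-1) e^(-x)] over the half-line, after [x = e^u]. *)
Definition euler_Gamma (s : C) : C := intC (fun u => Cmult (cexp s u) (RtoC (exp (- exp u)))).

Lemma Cdominated_euler_Gamma (s : C) : 0 < Re s -> Cdominated (fun u => Cmult (cexp s u) (RtoC (exp (- exp u)))).
Proof.
  intros Hs. apply (Cdominated_cexp _ _ _ _ _ (exp_bounded_exp_exp (Re s + 1) ltac:(lra))); lra.
Qed.

(** For integrands given by different formulas on the two sides of 0: the truncated [beta_kernel]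
    and the damping factor [exp (- e * Rabs t)]. *)
Lemma intR_derive_split (K : R) (F1 F2 f f1 f2 : R -> R) : dominated K f ->
  (forall x, x <= 0 -> f x = f1 x) -> (forall x, 0 <= x -> f x = f2 x) ->
  (forall x, is_derive F1 x (f1 x) /\ continuous f1 x) ->
  (forall x, is_derive F2 x (f2 x) /\ continuous f2 x) ->
  is_lim F1 m_infty 0 -> is_lim F2 p_infty 0 -> intR f = F1 0 - F2 0.
Proof.
  intros Hf H1 H2 D1 D2 L1 L2. apply (intR_unique K); auto. intros eta He.
  assert (He' : 0 < eta / 2) by lra.
  apply is_lim_spec in L1, L2.
  destruct (L1 (mkposreal _ He')) as [M1 HM1]. destruct (L2 (mkposreal _ He')) as [M2 HM2]. simpl in *.
  exists (Rmax (- M1) (Rmax M2 0) + 1). intros T HT.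
  pose proof (Rmax_l (- M1) (Rmax M2 0)). pose proof (Rmax_r (- M1) (Rmax M2 0)).
  pose proof (Rmax_l M2 0). pose proof (Rmax_r M2 0).
  rewrite <- (RInt_Chasles (V := R_CompleteNormedModule) f (- T) 0 T) by (apply ex_RInt_cont, Hf).
  rewrite (RInt_ext f f1 (- T) 0), (RInt_ext f f2 0 T).
  2: { intros x. rewrite Rmin_left by lra. intros. apply H2. lra. }
  2: { intros x. rewrite Rmax_right by lra. intros. apply H1. lra. }
  assert (I1 : is_RInt f1 (- T) 0 (F1 0 - F1 (- T))).
  { apply (is_RInt_derive (V := R_CompleteNormedModule)); intros; apply D1. }
  assert (I2 : is_RInt f2 0 T (F2 T - F2 0)).
  { apply (is_RInt_derive (V := R_CompleteNormedModule)); intros; apply D2. }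
  apply (is_RInt_unique (V := R_CompleteNormedModule)) in I1, I2. rewrite I1, I2.
  unfold plus; simpl.
  replace (_ + _ - _) with (- (F1 (- T) - 0) + (F2 T - 0)) by ring.
  eapply Rle_trans; [apply Rabs_triang|]. rewrite Rabs_Ropp.
  specialize (HM1 (- T) ltac:(lra)). specialize (HM2 T ltac:(lra)). lra.
Qed.

Definition cder (F f : R -> C) : Prop := forall u,
  (is_derive (fun u => Re (F u)) u (Re (f u)) /\ continuous (fun u => Re (f u)) u) /\
  (is_derive (fun u => Im (F u)) u (Im (f u)) /\ continuous (fun u => Im (f u)) u).

Lemma cder_cexp (c z : C) : cder (fun u => Cmult c (cexp z u)) (fun u => Cmult (Cmult c z) (cexp z u)).
Proof.
  intros u; split; (split; [|apply (ex_derive_continuous (V := R_NormedModule))]);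
  unfold Re, Im; simpl; auto_derive; auto; unfold Re, Im; ring.
Qed.

Lemma cder_minus (F G f g : R -> C) : cder F f -> cder G g ->
  cder (fun u => Cminus (F u) (G u)) (fun u => Cminus (f u) (g u)).
Proof.
  intros HF HG u. destruct (HF u) as [[A1 A2] [A3 A4]]. destruct (HG u) as [[B1 B2] [B3 B4]].
  split; split.
  - exact (is_derive_minus (K := R_AbsRing) (V := R_NormedModule) _ _ _ _ _ A1 B1).
  - exact (continuous_minus (V := R_NormedModule) _ _ _ A2 B2).
  - exact (is_derive_minus (K := R_AbsRing) (V := R_NormedModule) _ _ _ _ _ A3 B3).
  - exact (continuous_minus (V := R_NormedModule) _ _ _ A4 B4).
Qed.

Lemma cder_const0 : cder (fun _ => RtoC 0) (fun _ => RtoC 0).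
Proof.
  intros u; split; (split;
    [apply (is_derive_const (K := R_AbsRing) (V := R_NormedModule)) | apply continuous_const]).
Qed.

Lemma is_lim_Cmod_comp (F : R -> C) (x : Rbar) : is_lim (fun u => Cmod (F u)) x 0 ->
  is_lim (fun u => Re (F u)) x 0 /\ is_lim (fun u => Im (F u)) x 0.
Proof.
  intros H. assert (H' : is_lim (fun u => - Cmod (F u)) x 0).
  { replace (Finite 0) with (Rbar_opp 0) by (simpl; now rewrite Ropp_0). now apply is_lim_opp. }
  split; apply (is_lim_le_le_loc (fun u => - Cmod (F u)) (fun u => Cmod (F u))); auto;
    apply filter_forall; intros u; apply Rabs_le_between; [apply re_le_Cmod|apply Im_le_Cmod].
Qed.

Lemma intC_derive_split (F1 F2 f f1 f2 : R -> C) : Cdominated f ->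
  (forall x, x <= 0 -> f x = f1 x) -> (forall x, 0 <= x -> f x = f2 x) ->
  cder F1 f1 -> cder F2 f2 ->
  is_lim (fun u => Cmod (F1 u)) m_infty 0 -> is_lim (fun u => Cmod (F2 u)) p_infty 0 ->
  intC f = Cminus (F1 0) (F2 0).
Proof.
  intros [K [K1 K2]] H1 H2 D1 D2 L1 L2.
  apply is_lim_Cmod_comp in L1, L2. destruct L1 as [L1 L1']. destruct L2 as [L2 L2'].
  unfold intC. apply injective_projections; simpl.
  - apply (intR_derive_split K (fun u => Re (F1 u)) (fun u => Re (F2 u)) _ (fun u => Re (f1 u)) (fun u => Re (f2 u))); auto.
    intros; now rewrite H1. intros; now rewrite H2. intros; apply D1. intros; apply D2.
  - apply (intR_derive_split K (fun u => Im (F1 u)) (fun u => Im (F2 u)) _ (fun u => Im (f1 u)) (fun u => Im (f2 u))); auto.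
    intros; now rewrite H1. intros; now rewrite H2. intros; apply D1. intros; apply D2.
Qed.

Lemma is_lim_exp_lin_m (k a : R) : 0 < a -> is_lim (fun u => k * exp (a * u)) m_infty 0.
Proof.
  intros Ha. replace (Finite 0) with (Rbar_mult k 0) by (simpl; now rewrite Rmult_0_r).
  apply is_lim_scal_l. apply (is_lim_comp exp (fun u => a * u) m_infty 0 m_infty).
  - apply is_lim_exp_m.
  - apply is_lim_spec. intros M. exists (M / a). intros x Hx.
    apply (Rmult_lt_compat_l a) in Hx; auto. replace (a * (M / a)) with M in Hx by (field; lra). lra.
  - apply filter_forall. discriminate.
Qed.

Lemma is_lim_exp_lin_p (k a : R) : a < 0 -> is_lim (fun u => k * exp (a * u)) p_infty 0.
Proof.
  intros Ha. replace (Finite 0) with (Rbar_mult k 0) by (simpl; now rewrite Rmult_0_r).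
  apply is_lim_scal_l. apply (is_lim_comp exp (fun u => a * u) p_infty 0 m_infty).
  - apply is_lim_exp_m.
  - apply is_lim_spec. intros M. exists (M / a). intros x Hx.
    apply (Rmult_lt_compat_l (- a)) in Hx; [|lra]. replace (- a * (M / a)) with (- M) in Hx by (field; lra). lra.
  - apply filter_forall. discriminate.
Qed.

Lemma is_lim_cexp_m (c z : C) : 0 < Re z -> is_lim (fun u => Cmod (Cmult c (cexp z u))) m_infty 0.
Proof.
  intros Hz. apply (is_lim_ext (fun u => Cmod c * exp (Re z * u))).
  - intros u. now rewrite Cmod_mult, Cmod_cexp.
  - now apply is_lim_exp_lin_m.
Qed.

Lemma is_lim_cexp_p (c z : C) : Re z < 0 -> is_lim (fun u => Cmod (Cmult c (cexp z u))) p_infty 0.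
Proof.
  intros Hz. apply (is_lim_ext (fun u => Cmod c * exp (Re z * u))).
  - intros u. now rewrite Cmod_mult, Cmod_cexp.
  - now apply is_lim_exp_lin_p.
Qed.

Lemma cexp_0 (z : C) : cexp z 0 = RtoC 1.
Proof. unfold cexp. rewrite !Rmult_0_r, exp_0, cos_0, sin_0. unfold RtoC. f_equal; ring. Qed.

Lemma cexp_succ (s : C) (u : R) : cexp (Cplus s (RtoC 1)) u = Cmult (cexp s u) (RtoC (exp u)).
Proof. rewrite cexp_plus_l, cexp_RtoC, Rmult_1_l. reflexivity. Qed.

Lemma Re_neq_0 (z : C) : 0 < Re z -> z <> RtoC 0.
Proof. intros H ->. simpl in H. lra. Qed.

(* Its [n]-th power has Mellin integral [n! / (s (s+1) ... (s+n))]. *)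
Definition beta_kernel (u : R) : R := Rmax 0 (1 - exp u).

Lemma beta_kernel_continuous (u : R) : continuous beta_kernel u.
Proof.
  apply (continuous_ext (fun u => / 2 * ((1 - exp u) + Rabs (1 - exp u)))).
  - intros x. unfold beta_kernel, Rmax. destruct (Rle_dec 0 (1 - exp x)).
    rewrite Rabs_right; simpl; lra. rewrite Rabs_left; simpl; lra.
  - apply (continuous_scal_r (V := R_NormedModule)). apply (continuous_plus (V := R_NormedModule)).
    apply (ex_derive_continuous (V := R_NormedModule)). now auto_derive.
    apply (continuous_comp (fun u => 1 - exp u) Rabs); [|apply continuous_Rabs].
    apply (ex_derive_continuous (V := R_NormedModule)). now auto_derive.
Qed.

Lemma continuous_pow (f : R -> R) (n : nat) (u : R) : continuous f u -> continuous (fun u => f u ^ n) u.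
Proof.
  intros H. induction n; simpl. apply continuous_const. now apply (continuous_mult (K := R_AbsRing)).
Qed.

Lemma beta_kernel_bounds (x : R) : 0 <= Rmax 0 (1 - x) <= exp (- x).
Proof.
  split; [apply Rmax_l|]. pose proof (exp_pos (- x)). pose proof (exp_ineq1_le (- x)).
  apply Rmax_lub; lra.
Qed.

Lemma pow_exp (x : R) (n : nat) : exp x ^ n = exp (INR n * x).
Proof.
  induction n; [simpl; now rewrite Rmult_0_l, exp_0|].
  rewrite S_INR, Rmult_plus_distr_r, exp_plus, Rmult_1_l, <- IHn. simpl; ring.
Qed.

(* The power of the beta kernel shifted by [ln n], which produces the factor [n^s] of Gauss' formula. *)
Definition gauss_kernel (n : nat) (u : R) : R := (Rmax 0 (1 - exp (u - ln (INR n)))) ^ n.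

(** The [n]-th power of [1 - y <= exp (- y)] at [y = e^u / n]. The resulting majorant is the same
    for all [n], as dominated convergence requires. *)
Lemma gauss_kernel_bounds (n : nat) (u : R) : (0 < n)%nat -> 0 <= gauss_kernel n u <= exp (- exp u).
Proof.
  intros Hn. apply lt_0_INR in Hn. unfold gauss_kernel. destruct (beta_kernel_bounds (exp (u - ln (INR n)))) as [H1 H2].
  split; [now apply pow_le|]. eapply Rle_trans; [apply pow_incr; split; eassumption|].
  rewrite pow_exp. apply exp_le_compat. unfold Rminus. rewrite exp_plus, exp_Ropp, exp_ln by auto.
  right. field. lra.
Qed.

Lemma gauss_kernel_continuous (n : nat) (u : R) : continuous (gauss_kernel n) u.
Proof.
  apply (continuous_pow (fun u => beta_kernel (u - ln (INR n)))).
  apply (continuous_comp (fun u => u - ln (INR n)) beta_kernel); [|apply beta_kernel_continuous].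
  apply (ex_derive_continuous (V := R_NormedModule)). now auto_derive.
Qed.

Lemma exp_bounded_gauss_kernel (n : nat) (B : R) : (0 < n)%nat -> 0 <= B -> exp_bounded (exp (B ^ 2)) 0 B (gauss_kernel n).
Proof.
  intros Hn HB. apply (exp_bounded_le _ _ _ (fun u => exp (- exp u))); [apply gauss_kernel_continuous| |now apply exp_bounded_exp_exp].
  intros u. destruct (gauss_kernel_bounds n u Hn). rewrite !Rabs_right; try lra; left; apply exp_pos.
Qed.

(** With [x = e^u <= n] the truncation is inactive. Bernoulli's inequality and [1 + x/n <= e^(x/n)]
    give [1 - x^2/n <= (1 - (x/n)^2)^n <= e^x (1 - x/n)^n], so the error is at most
    [e^(-x) x^2 / n]. *)
Lemma gauss_kernel_close (n : nat) (u T : R) : exp T <= INR n -> Rabs u <= T ->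
  Rabs (gauss_kernel n u - exp (- exp u)) <= exp (2 * T) / INR n.
Proof.
  intros Hn Hu. pose proof (exp_pos T). pose proof (exp_pos u). pose proof (Rle_abs u).
  assert (Hn0 : (0 < n)%nat) by (apply INR_lt; simpl; lra).
  destruct (gauss_kernel_bounds n u Hn0) as [_ H2].
  assert (Hx : exp u <= exp T) by (apply exp_le_compat; lra).
  rewrite Rabs_minus_sym, Rabs_right by lra.
  set (x := exp u) in *. set (N := INR n) in *.
  assert (E1 : gauss_kernel n u = (1 - x / N) ^ n).
  { unfold gauss_kernel. fold N. unfold Rminus at 2. rewrite exp_plus, exp_Ropp, exp_ln by lra. fold x.
    f_equal. apply Rmax_right. assert (x * / N <= 1); [|lra].
    apply (Rmult_le_reg_r N); [lra|]. rewrite Rmult_assoc, Rinv_l; lra. }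
  assert (Hxn : 0 <= x / N <= 1).
  { split. apply Rdiv_le_0_compat; lra. apply (Rmult_le_reg_r N); [lra|].
    unfold Rdiv. rewrite Rmult_assoc, Rinv_l; lra. }
  assert (H3 : 1 - x ^ 2 / N <= (1 - (x / N) ^ 2) ^ n).
  { assert (B : forall k y, 0 <= y <= 1 -> 1 - INR k * y <= (1 - y) ^ k).
    { intros k y Hy. induction k; [simpl; lra|]. rewrite S_INR. simpl.
      assert (0 <= (1 - y) ^ k) by (apply pow_le; lra). pose proof (pos_INR k). nra. }
    eapply Rle_trans; [|apply B; nra]. right. fold N. field. lra. }
  assert (H4 : (1 - (x / N) ^ 2) ^ n <= exp x * gauss_kernel n u).
  { rewrite E1. replace (1 - (x / N) ^ 2) with ((1 + x / N) * (1 - x / N)) by ring.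
    rewrite Rpow_mult_distr. apply Rmult_le_compat_r; [apply pow_le; lra|].
    eapply Rle_trans; [apply pow_incr; split; [lra|apply exp_ineq1_le]|].
    rewrite pow_exp. apply exp_le_compat. fold N. right. field. lra. }
  assert (H5 : exp (- x) * (1 - x ^ 2 / N) <= gauss_kernel n u).
  { replace (gauss_kernel n u) with (exp (- x) * (exp x * gauss_kernel n u)).
    apply Rmult_le_compat_l; [left; apply exp_pos|lra].
    rewrite <- Rmult_assoc, <- exp_plus, Rplus_opp_l, exp_0. ring. }
  assert (H6 : exp (- x) <= 1) by (rewrite <- exp_0; apply exp_le_compat; lra).
  assert (H7 : x ^ 2 / N <= exp (2 * T) / N).
  { unfold Rdiv. apply Rmult_le_compat_r. left; apply Rinv_0_lt_compat; lra.
    replace (2 * T) with (T + T) by ring. rewrite exp_plus. nra. }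
  assert (0 <= x ^ 2 / N) by (apply Rdiv_le_0_compat; nra).
  pose proof (exp_pos (- x)). nra.
Qed.

(** Has [n + 1] factors, as in the denominator of [gauss_seq]: one more than the usual Pochhammer
    symbol of index [n]. *)
Definition poch (s : C) (n : nat) : C :=
  Cprod_list (map (fun k => Cplus s (RtoC (INR k))) (seq 0 (S n))).

Lemma Cprod_list_app (l l' : list C) : Cprod_list (l ++ l') = Cmult (Cprod_list l) (Cprod_list l').
Proof. induction l; simpl; [now rewrite Cmult_1_l|]. now rewrite IHl, Cmult_assoc. Qed.

Lemma poch_S (s : C) (n : nat) : poch s (S n) = Cmult (poch s n) (Cplus s (RtoC (INR (S n)))).
Proof.
  unfold poch. rewrite (seq_S (S n)), map_app, Cprod_list_app. cbn [map Cprod_list].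
  now rewrite Cmult_1_r.
Qed.

Lemma poch_shift (s : C) (n : nat) : poch s (S n) = Cmult s (poch (Cplus s (RtoC 1)) n).
Proof.
  unfold poch.
  replace (seq 0 (S (S n))) with (0%nat :: map S (seq 0 (S n))) by (rewrite seq_shift; reflexivity).
  rewrite map_cons, map_map. change (INR 0) with 0. rewrite Cplus_0_r.
  cbn [Cprod_list]. do 2 f_equal.
  apply map_ext. intros k. rewrite S_INR, RtoC_plus. ring.
Qed.

Lemma poch_neq_0 (s : C) (n : nat) : 0 < Re s -> poch s n <> RtoC 0.
Proof.
  intros Hs. induction n as [|n IH].
  - unfold poch; simpl. rewrite Cplus_0_r, Cmult_1_r. now apply Re_neq_0.
  - rewrite poch_S. apply Cmult_neq_0; auto. apply Re_neq_0.
    pose proof (pos_INR (S n)). unfold Re in *. simpl fst in *. change (0 < fst s + INR (S n)). lra.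
Qed.

Lemma Cdominated_beta_kernel (s : C) (n : nat) : 0 < Re s ->
  Cdominated (fun u => Cmult (cexp s u) (RtoC (beta_kernel u ^ S n))).
Proof.
  intros Hs.
  apply (Cdominated_ext (fun u => Cmult (cexp s u) (RtoC ((fun u => beta_kernel u ^ S n) u)))); [easy|].
  apply (Cdominated_cexp (exp ((Re s + 1) ^ 2)) 0 (Re s + 1)); [|lra|lra].
  apply (exp_bounded_le _ _ _ (fun u => exp (- exp u))); [intros; apply continuous_pow, beta_kernel_continuous| |apply exp_bounded_exp_exp; lra].
  intros u. unfold beta_kernel. destruct (beta_kernel_bounds (exp u)) as [H1 H2].
  assert (H3 : Rmax 0 (1 - exp u) <= 1) by (pose proof (exp_pos u); apply Rmax_lub; lra).
  assert (0 <= Rmax 0 (1 - exp u) ^ n <= 1).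
  { split; [now apply pow_le|]. eapply Rle_trans; [apply pow_incr; split; eassumption|]. rewrite pow1. lra. }
  assert (0 <= Rmax 0 (1 - exp u) ^ S n) by (now apply pow_le). simpl in *.
  rewrite !Rabs_right; try lra; nra.
Qed.

(** Induction from [(1 - x)^(n+1) = (1 - x)^n - x (1 - x)^n]: the integral at [s] for the next power
    is the difference of those at [s] and [s + 1], and over the common denominator the numerators
    leave [(s + n + 2) - s]. The exponent starts at 1 because the zeroth power is constantly 1, also
    for [u > 0], where [e^(s u)] is not integrable. *)
Lemma intC_beta_kernel (n : nat) : forall s, 0 < Re s ->
  intC (fun u => Cmult (cexp s u) (RtoC (beta_kernel u ^ S n))) = Cdiv (RtoC (INR (fact (S n)))) (poch s (S n)).
Proof.
  induction n as [|n IH]; intros s Hs.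
  - assert (Hs1 : 0 < Re (Cplus s (RtoC 1))) by (simpl; unfold Re in Hs; lra).
    rewrite (intC_derive_split
      (fun u => Cminus (Cmult (Cinv s) (cexp s u)) (Cmult (Cinv (Cplus s (RtoC 1))) (cexp (Cplus s (RtoC 1)) u)))
      (fun u => RtoC 0) _
      (fun u => Cminus (Cmult (Cmult (Cinv s) s) (cexp s u))
          (Cmult (Cmult (Cinv (Cplus s (RtoC 1))) (Cplus s (RtoC 1))) (cexp (Cplus s (RtoC 1)) u)))
      (fun u => RtoC 0)).
    + rewrite !cexp_0. unfold poch. simpl. field.
      split; now apply Re_neq_0.
    + now apply Cdominated_beta_kernel.
    + intros u Hu. rewrite !Cinv_l, cexp_succ by now apply Re_neq_0. unfold beta_kernel. simpl pow.
      assert (exp u <= 1) by (rewrite <- exp_0; now apply exp_le_compat).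
      rewrite Rmax_right, Rmult_1_r, RtoC_minus by lra. ring.
    + intros u Hu. unfold beta_kernel. simpl pow.
      assert (1 <= exp u) by (rewrite <- exp_0; now apply exp_le_compat).
      rewrite Rmax_left, Rmult_0_l by lra. ring.
    + apply cder_minus; apply cder_cexp.
    + apply cder_const0.
    + apply (is_lim_le_le_loc (fun _ => 0)
        (fun u => Cmod (Cmult (Cinv s) (cexp s u)) + Cmod (Cmult (Cinv (Cplus s (RtoC 1))) (cexp (Cplus s (RtoC 1)) u)))).
      * apply filter_forall. intros u. split; [apply Cmod_ge_0|].
        eapply Rle_trans; [apply Cmod_triangle|]. rewrite Cmod_opp. apply Rle_refl.
      * apply is_lim_const.
      * replace (Finite 0) with (Rbar_plus 0 0) by (simpl; f_equal; ring).
        apply is_lim_plus'; now apply is_lim_cexp_m.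
    + apply (is_lim_ext (fun _ => 0)); [intros; now rewrite Cmod_0|apply is_lim_const].
  - assert (Hs1 : 0 < Re (Cplus s (RtoC 1))) by (simpl; unfold Re in Hs; lra).
    rewrite (intC_ext _ (fun u => Cplus (Cmult (cexp s u) (RtoC (beta_kernel u ^ S n)))
       (Cmult (RtoC (-1)) (Cmult (cexp (Cplus s (RtoC 1)) u) (RtoC (beta_kernel u ^ S n)))))).
    2: { intros u. rewrite cexp_succ.
      assert (beta_kernel u ^ S (S n) = (1 - exp u) * beta_kernel u ^ S n) as ->.
      { simpl. unfold beta_kernel, Rmax. destruct (Rle_dec 0 (1 - exp u)); ring. }
      rewrite RtoC_mult, RtoC_minus. ring. }
    pose proof (Cdominated_beta_kernel s n Hs) as G0. pose proof (Cdominated_beta_kernel _ n Hs1) as G1.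
    rewrite (intC_plus _ _ G0 (Cdominated_cmult (RtoC (-1)) _ G1)), (intC_cmult _ _ G1).
    rewrite !IH by auto.
    pose proof (poch_neq_0 s (S n) Hs) as N1. pose proof (poch_neq_0 _ (S n) Hs1) as N2.
    pose proof (poch_neq_0 s (S (S n)) Hs) as N3. pose proof (Re_neq_0 _ Hs) as N4.
    assert (N5 : Cplus s (RtoC (INR (S (S n)))) <> RtoC 0).
    { intros Z. rewrite poch_S, Z, Cmult_0_r in N3. now apply N3. }
    pose proof (poch_shift s (S n)) as P2. pose proof (poch_S s (S n)) as P1.
    assert (Q1 : Cinv (poch s (S n)) = Cmult (Cplus s (RtoC (INR (S (S n))))) (Cinv (poch s (S (S n))))).
    { rewrite P1. field. now split. }
    assert (Q2 : Cinv (poch (Cplus s (RtoC 1)) (S n)) = Cmult s (Cinv (poch s (S (S n))))).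
    { rewrite P2. field. now split. }
    unfold Cdiv. rewrite Q1, Q2, (fact_simpl (S n)), mult_INR, RtoC_mult.
    ring.
Qed.

Lemma intC_gauss_kernel (n : nat) (s : C) : 0 < Re s ->
  intC (fun u => Cmult (cexp s u) (RtoC (gauss_kernel (S n) u))) = gauss_seq s (S n).
Proof.
  intros Hs. assert (HN : (0 < S n)%nat) by lia.
  rewrite <- (intC_shift (ln (INR (S n)))).
  2: { apply (Cdominated_cexp _ _ _ _ _ (exp_bounded_gauss_kernel (S n) (Re s + 1) HN ltac:(lra))); lra. }
  rewrite (intC_ext _ (fun u => Cmult (cexp s (ln (INR (S n)))) (Cmult (cexp s u) (RtoC (beta_kernel u ^ S n))))).
  2: { intros u. unfold gauss_kernel. replace (u + ln (INR (S n)) - ln (INR (S n))) with u by ring.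
    rewrite cexp_plus_r. unfold beta_kernel. ring. }
  rewrite intC_cmult by now apply Cdominated_beta_kernel. rewrite intC_beta_kernel by auto.
  unfold gauss_seq. change (Cpowr (INR (S n)) s) with (cexp s (ln (INR (S n)))).
  unfold poch, Cdiv. ring.
Qed.

(** The shift to [S n] skips index 0, where the kernel is constantly 1 and not integrable against
    [e^(s u)]. *)
Lemma gauss_lim (s : C) : 0 < Re s ->
  is_lim_seq (fun n => Re (gauss_seq s (S n))) (Re (euler_Gamma s)) /\
  is_lim_seq (fun n => Im (gauss_seq s (S n))) (Im (euler_Gamma s)).
Proof.
  intros Hs.
  destruct (Cdominated_cexp_uniform (exp ((Re s + 1) ^ 2)) 0 (Re s + 1) (Re s)) as [K HK]; [lra|lra|].
  assert (Hn : forall n, exp_bounded (exp ((Re s + 1) ^ 2)) 0 (Re s + 1) (gauss_kernel (S n))) by (intros; apply exp_bounded_gauss_kernel; [lia|lra]).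
  pose proof (HK s _ eq_refl (exp_bounded_exp_exp (Re s + 1) ltac:(lra))) as [H1 H2].
  assert (HU : forall T eta, 0 < T -> 0 < eta -> eventually (fun n => forall x, Rabs x <= T ->
      Cmod (Cminus (Cmult (cexp s x) (RtoC (gauss_kernel (S n) x))) (Cmult (cexp s x) (RtoC (exp (- exp x))))) <= eta)).
  (* The summand [exp T] makes [gauss_kernel_close] applicable; the other one brings
     [exp (Re s * T) * exp (2 * T) / n] below [eta]. *)
  { intros T eta HT He. set (X := exp (Re s * T) * exp (2 * T) / eta + exp T).
    destruct (nfloor_ex X) as [N HN].
    { unfold X. pose proof (exp_pos T). pose proof (exp_pos (Re s * T)). pose proof (exp_pos (2 * T)).
      apply Rplus_le_le_0_compat; [|lra]. apply Rdiv_le_0_compat; nra. }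
    exists N. intros n Hge x Hx. apply le_INR in Hge.
    assert (HX : X <= INR (S n)) by (rewrite S_INR; lra).
    replace (Cminus _ _) with (Cmult (cexp s x) (RtoC (gauss_kernel (S n) x - exp (- exp x)))) by (rewrite RtoC_minus; ring).
    rewrite Cmod_mult, Cmod_cexp, Cmod_R.
    pose proof (exp_pos T). pose proof (exp_pos (Re s * T)). pose proof (exp_pos (2 * T)).
    assert (0 < exp (Re s * T) * exp (2 * T) / eta) by (apply Rdiv_lt_0_compat; nra).
    unfold X in HX.
    pose proof (gauss_kernel_close (S n) x T ltac:(lra) Hx) as C.
    assert (exp (Re s * x) <= exp (Re s * T)).
    { apply exp_le_compat. pose proof (Rle_abs x). nra. }
    pose proof (exp_pos (Re s * x)). pose proof (Rabs_pos (gauss_kernel (S n) x - exp (- exp x))).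
    apply Rle_trans with (exp (Re s * T) * (exp (2 * T) / INR (S n))); [apply Rmult_le_compat; lra|].
    apply (Rmult_le_reg_r (INR (S n))); [lra|].
    replace (_ * _ * _) with (exp (Re s * T) * exp (2 * T)) by (field; lra).
    replace (exp (Re s * T) * exp (2 * T)) with (eta * (exp (Re s * T) * exp (2 * T) / eta)) by (field; lra).
    apply Rmult_le_compat_l; lra. }
  split.
  - apply (is_lim_seq_ext (fun n => intR (fun u => Re (Cmult (cexp s u) (RtoC (gauss_kernel (S n) u)))))).
    { intros n. rewrite <- intC_gauss_kernel by auto. reflexivity. }
    apply (intR_dominated K _ _ (fun n => proj1 (HK s _ eq_refl (Hn n))) H1).
    intros T eta HT He. destruct (HU T eta HT He) as [N HN]. exists N. intros n Hge x Hx.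
    eapply Rle_trans; [|apply (HN n Hge x Hx)]. eapply Rle_trans; [|apply re_le_Cmod]. apply Rle_refl.
  - apply (is_lim_seq_ext (fun n => intR (fun u => Im (Cmult (cexp s u) (RtoC (gauss_kernel (S n) u)))))).
    { intros n. rewrite <- intC_gauss_kernel by auto. reflexivity. }
    apply (intR_dominated K _ _ (fun n => proj2 (HK s _ eq_refl (Hn n))) H2).
    intros T eta HT He. destruct (HU T eta HT He) as [N HN]. exists N. intros n Hge x Hx.
    eapply Rle_trans; [|apply (HN n Hge x Hx)]. eapply Rle_trans; [|apply Im_le_Cmod]. apply Rle_refl.
Qed.

Lemma CGamma_euler_Gamma (s : C) : 0 < Re s -> CGamma s = euler_Gamma s.
Proof.
  intros Hs. destruct (gauss_lim s Hs) as [H1 H2].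
  apply (is_lim_seq_incr_1 (fun n => Re (gauss_seq s n))) in H1.
  apply (is_lim_seq_incr_1 (fun n => Im (gauss_seq s n))) in H2.
  unfold CGamma. rewrite (is_lim_seq_unique _ _ H1), (is_lim_seq_unique _ _ H2).
  apply injective_projections; reflexivity.
Qed.

(** * Functional equations of the Gamma function *)

Definition Ccont2 (F : R -> R -> C) : Prop :=
  cont2 (fun x y => Re (F x y)) /\ cont2 (fun x y => Im (F x y)).

Lemma Ccont2_ext (F G : R -> R -> C) : (forall x y, F x y = G x y) -> Ccont2 F -> Ccont2 G.
Proof.
  intros H [H1 H2]. split; intros x y.
  - apply (continuity_2d_pt_ext (fun x y => Re (F x y))); [|apply H1]. intros; now rewrite H.
  - apply (continuity_2d_pt_ext (fun x y => Im (F x y))); [|apply H2]. intros; now rewrite H.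
Qed.

Lemma Ccont2_mult (F G : R -> R -> C) : Ccont2 F -> Ccont2 G -> Ccont2 (fun x y => Cmult (F x y) (G x y)).
Proof.
  intros [H1 H2] [H3 H4]. split; intros x y; simpl.
  - apply continuity_2d_pt_minus; apply continuity_2d_pt_mult; [apply H1|apply H3|apply H2|apply H4].
  - apply continuity_2d_pt_plus; apply continuity_2d_pt_mult; [apply H1|apply H4|apply H2|apply H3].
Qed.

Lemma cont2_comp (f : R -> R) (g : R -> R -> R) : (forall x, continuous f x) -> cont2 g -> cont2 (fun x y => f (g x y)).
Proof.
  intros Hf Hg x y. apply continuity_1d_2d_pt_comp; [|apply Hg]. apply continuity_pt_filterlim, Hf.
Qed.

Lemma Ccont2_comp (f : R -> C) (g : R -> R -> R) : (forall x, continuous (fun x => Re (f x)) x) ->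
  (forall x, continuous (fun x => Im (f x)) x) -> cont2 g -> Ccont2 (fun x y => f (g x y)).
Proof.
  intros H1 H2 Hg. split.
  - now apply (cont2_comp (fun x => Re (f x))).
  - now apply (cont2_comp (fun x => Im (f x))).
Qed.

Lemma Ccont2_cexp (s : C) (g : R -> R -> R) : cont2 g -> Ccont2 (fun x y => cexp s (g x y)).
Proof. apply Ccont2_comp; intros; [apply continuous_exp_cos|apply continuous_exp_sin]. Qed.

Lemma Ccont2_RtoC (f : R -> R) (g : R -> R -> R) : (forall x, continuous f x) -> cont2 g ->
  Ccont2 (fun x y => RtoC (f (g x y))).
Proof.
  intros Hf. apply (Ccont2_comp (fun x => RtoC (f x))); [exact Hf|]. intros x. apply continuous_const.
Qed.

Lemma cont2_1 : cont2 (fun x y => x).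
Proof. intros x y. apply continuity_2d_pt_id1. Qed.

Lemma cont2_2 : cont2 (fun x y => y).
Proof. intros x y. apply continuity_2d_pt_id2. Qed.

Lemma Cdominated2_intro (K : R) (F : R -> R -> C) : Ccont2 F ->
  (forall x y, Cmod (F x y) <= K * / (1 + x ^ 2) * / (1 + y ^ 2)) -> Cdominated2 F.
Proof.
  intros [H1 H2] H. exists K. split; (split; [assumption|]); intros x y;
   (eapply Rle_trans; [|apply H]); [apply re_le_Cmod|apply Im_le_Cmod].
Qed.

(** Decay in [Rabs u], so that the triangle inequality can handle the argument [w + v] of the double
    integral below. The rate 1 at plus infinity comes from taking [B = a + 1] in
    [exp_bounded_exp_exp]. *)
Lemma euler_Gamma_kernel_abs (a : R) : 0 < a -> exists A, 0 <= A /\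
  forall u, exp (a * u) * exp (- exp u) <= A * exp (- (Rmin a 1) * Rabs u).
Proof.
  intros Ha. destruct (exp_bounded_exp_exp (a + 1) ltac:(lra)) as [_ B].
  set (A := exp ((a + 1) ^ 2)) in *. exists A. assert (HA : 0 < A) by apply exp_pos.
  split; [lra|]. intros u. destruct (B u) as [B1 B2].
  rewrite Rabs_right in B1, B2 by (left; apply exp_pos).
  rewrite Rmult_0_l, exp_0 in B1. pose proof (exp_pos (a * u)).
  assert (exp (a * u) * exp (- exp u) * / A <= exp (- (Rmin a 1) * Rabs u)).
  { apply exp_abs_le; try lra; apply (Rmult_le_reg_r A); try lra; rewrite Rmult_assoc, Rinv_l, Rmult_1_r by lra.
    - nra.
    - assert (exp (- (1) * u) = exp (a * u) * exp (- (a + 1) * u)) as -> by (rewrite <- exp_plus; f_equal; ring). nra. }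
  apply (Rmult_le_compat_r A) in H0; [|lra].
  rewrite Rmult_assoc, Rinv_l, Rmult_1_r in H0 by lra. lra.
Qed.

Lemma Cdominated2_euler_Gamma (p q : C) : 0 < Re p -> 0 < Re q ->
  Cdominated2 (fun v w => Cmult (Cmult (cexp q v) (RtoC (exp (- exp v)))) (Cmult (cexp p (w + v)) (RtoC (exp (- exp (w + v)))))).
Proof.
  intros Hp Hq. destruct (euler_Gamma_kernel_abs _ Hp) as [A [HA1 HA2]]. destruct (euler_Gamma_kernel_abs _ Hq) as [B [HB1 HB2]].
  set (e := Rmin (Rmin (Re p) 1) (Rmin (Re q) 1)).
  assert (He : 0 < e) by (unfold e; repeat apply Rmin_glb_lt; lra).
  assert (He1 : e <= Rmin (Re p) 1) by apply Rmin_l. assert (He2 : e <= Rmin (Re q) 1) by apply Rmin_r.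
  assert (He' : 0 < e / 2) by lra.
  set (k := 1 + 4 / (e / 2) ^ 2).
  apply (Cdominated2_intro (B * A * (k * k))).
  - assert (Hc : forall x, continuous (fun u => exp (- exp u)) x).
    { intros u. apply (ex_derive_continuous (V := R_NormedModule)). now auto_derive. }
    assert (Hs : cont2 (fun v w => w + v)).
    { intros x y. apply continuity_2d_pt_plus; [apply cont2_2|apply cont2_1]. }
    apply Ccont2_mult; apply Ccont2_mult.
    + apply Ccont2_cexp, cont2_1.
    + apply (Ccont2_RtoC (fun u => exp (- exp u))); [auto|apply cont2_1].
    + now apply Ccont2_cexp.
    + now apply (Ccont2_RtoC (fun u => exp (- exp u)) (fun v w => w + v)).
  - intros v w. rewrite !Cmod_mult, !Cmod_cexp, !Cmod_R, !Rabs_right by (left; apply exp_pos).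
    pose proof (exp_abs_cauchy (e / 2) v He') as C1. pose proof (exp_abs_cauchy (e / 2) w He') as C2. fold k in C1, C2.
    assert (D1 : exp (Re q * v) * exp (- exp v) <= B * exp (- e * Rabs v)).
    { eapply Rle_trans; [apply HB2|]. apply Rmult_le_compat_l; auto. apply exp_le_compat. pose proof (Rabs_pos v). nra. }
    assert (D2 : exp (Re p * (w + v)) * exp (- exp (w + v)) <= A * exp (- e * Rabs (w + v))).
    { eapply Rle_trans; [apply HA2|]. apply Rmult_le_compat_l; auto. apply exp_le_compat. pose proof (Rabs_pos (w + v)). nra. }
    (* Half of the decay in [v] is kept; the other half, joined with the decay in [w + v], yields
       decay in [w] because [Rabs w <= Rabs (w + v) + Rabs v]. *)
    assert (D3 : exp (- e * Rabs v) * exp (- e * Rabs (w + v)) <= exp (- (e / 2) * Rabs v) * exp (- (e / 2) * Rabs w)).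
    { rewrite <- !exp_plus. apply exp_le_compat.
      assert (Rabs w <= Rabs (w + v) + Rabs v).
      { replace w with ((w + v) + - v) at 1 by ring. rewrite <- (Rabs_Ropp v). apply Rabs_triang. }
      pose proof (Rabs_pos (w + v)). nra. }
    pose proof (exp_pos (- (e / 2) * Rabs v)). pose proof (exp_pos (- (e / 2) * Rabs w)).
    apply Rle_trans with ((B * exp (- e * Rabs v)) * (A * exp (- e * Rabs (w + v)))).
    { apply Rmult_le_compat; auto; apply Rmult_le_pos; left; apply exp_pos. }
    replace (_ * _ * (A * _)) with (B * A * (exp (- e * Rabs v) * exp (- e * Rabs (w + v)))) by ring.
    rewrite !Rmult_assoc. rewrite <- (Rmult_assoc B A), <- (Rmult_assoc B A (k * _)).
    apply Rmult_le_compat_l; [nra|]. eapply Rle_trans; [apply D3|].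
    apply Rle_trans with ((k * / (1 + v ^ 2)) * (k * / (1 + w ^ 2))); [|right; ring].
    apply Rmult_le_compat; lra.
Qed.

(** Serves twice at [x = e^u]: as [ln (1 + x)] itself and, through [exp (- k * softplus u)], as the
    power [(1 + x)^(-k)]. *)
Definition softplus (u : R) : R := ln (1 + exp u).

Lemma exp_softplus (u : R) : exp (softplus u) = 1 + exp u.
Proof. apply exp_ln. pose proof (exp_pos u); lra. Qed.

Lemma softplus_ge (u : R) : 0 <= softplus u /\ u <= softplus u /\ softplus u <= exp u.
Proof.
  pose proof (exp_pos u). unfold softplus. repeat split.
  - rewrite <- ln_1. apply ln_le; lra.
  - rewrite <- (ln_exp u) at 1. apply ln_le; lra.
  - rewrite <- (ln_exp (exp u)) at 2. apply ln_le; [lra|]. apply exp_ineq1_le.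
Qed.

Lemma exp_bounded_pow (k : R) : 0 < k -> exp_bounded 1 0 k (fun w => exp (- k * softplus w)).
Proof.
  intros Hk. split.
  - intros u. apply (ex_derive_continuous (V := R_NormedModule)). unfold softplus. auto_derive.
    pose proof (exp_pos u). lra.
  - intros u. destruct (softplus_ge u) as [H1 [H2 H3]]. rewrite Rabs_right by (left; apply exp_pos).
    rewrite !Rmult_1_l. split; apply exp_le_compat; nra.
Qed.

(** The beta integral in logarithmic variables. In the product of the two Euler integrals one
    variable is shifted by the other, so that [w] is the logarithm of their ratio. After Fubini the
    exponent is [- e^v (1 + e^w)], and the shift [v + softplus w] absorbs the factor [1 + e^w],
    leaving [Gamma(k)] times [(1 + e^w)^(-k)]. *)
Lemma euler_Gamma_mult (p q : C) (k : R) : 0 < Re p -> 0 < Re q -> Cplus p q = RtoC k ->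
  Cmult (euler_Gamma p) (euler_Gamma q) = Cmult (euler_Gamma (RtoC k)) (intC (fun w => Cmult (cexp p w) (RtoC (exp (- k * softplus w))))).
Proof.
  intros Hp Hq Hk.
  assert (Hk' : k = Re p + Re q) by (change k with (Re (RtoC k)); rewrite <- Hk; reflexivity).
  pose proof (Cdominated_euler_Gamma p Hp) as Gp. pose proof (Cdominated_euler_Gamma q Hq) as Gq.
  assert (Gk : Cdominated (fun u => Cmult (cexp (RtoC k) u) (RtoC (exp (- exp u))))) by (apply Cdominated_euler_Gamma; simpl; lra).
  assert (Hshift : forall (f : R -> C) w, Cdominated f -> Cdominated (fun x => f (x + w))).
  { intros f w Hf. apply (Cdominated_ext (fun x => f (1 * x + w))); [intros; now rewrite Rmult_1_l|].
    apply Cdominated_comp_lin; auto; lra. }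
  unfold euler_Gamma at 2. rewrite <- intC_cmult by auto.
  rewrite (intC_ext _ (fun v => intC (fun w => Cmult (Cmult (cexp q v) (RtoC (exp (- exp v)))) (Cmult (cexp p (w + v)) (RtoC (exp (- exp (w + v)))))))).
  2: { intros v. rewrite (intC_cmult _ (fun w => Cmult (cexp p (w + v)) (RtoC (exp (- exp (w + v)))))) by exact (Hshift _ v Gp).
    rewrite (intC_shift v _ Gp). apply Cmult_comm. }
  rewrite intC_Fubini by now apply Cdominated2_euler_Gamma.
  rewrite <- intC_cmult.
  2: { apply (Cdominated_cexp _ _ _ _ _ (exp_bounded_pow k ltac:(lra))); lra. }
  apply intC_ext. intros w.
  rewrite (intC_ext _ (fun v => Cmult (Cmult (cexp p w) (cexp (RtoC k) (- softplus w)))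
     (Cmult (cexp (RtoC k) (v + softplus w)) (RtoC (exp (- exp (v + softplus w))))))).
  2: { intros v. rewrite (exp_plus v (softplus w)), exp_softplus.
    replace (- (exp v * (1 + exp w))) with (- exp v + - exp (w + v)) by (rewrite exp_plus; ring).
    rewrite (exp_plus (- exp v)), RtoC_mult, (cexp_plus_r p).
    transitivity (Cmult (Cmult (cexp p w) (cexp (RtoC k) (- softplus w + (v + softplus w)))) (Cmult (RtoC (exp (- exp v))) (RtoC (exp (- exp (w + v)))))).
    - replace (- softplus w + (v + softplus w)) with v by ring. rewrite <- Hk, cexp_plus_l. ring.
    - rewrite cexp_plus_r. ring. }
  rewrite intC_cmult by exact (Hshift _ (softplus w) Gk). rewrite (intC_shift (softplus w) _ Gk).
  fold (euler_Gamma (RtoC k)). rewrite cexp_RtoC. replace (k * - softplus w) with (- k * softplus w) by ring. ring.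
Qed.

Lemma euler_Gamma_succ (s : C) : 0 < Re s -> euler_Gamma (Cplus s (RtoC 1)) = Cmult s (euler_Gamma s).
Proof.
  intros Hs. pose proof (exp_bounded_exp_exp (Re s + 2) ltac:(lra)) as B.
  assert (B' : exp_bounded (exp ((Re s + 2) ^ 2)) 1 (Re s + 1) (fun u => - exp u * exp (- exp u))).
  { split.
    - intros u. apply (ex_derive_continuous (V := R_NormedModule)). now auto_derive.
    - intros u. destruct B as [_ B]. destruct (B u) as [B1 B2]. pose proof (exp_pos u).
      rewrite Rabs_mult, Rabs_Ropp, (Rabs_right (exp u)) by lra. rewrite Rmult_0_l, exp_0 in B1. split.
      + rewrite Rmult_1_l. nra.
      + assert (exp (- (Re s + 1) * u) = exp u * exp (- (Re s + 2) * u)) as -> by (rewrite <- exp_plus; f_equal; ring). nra. }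
  unfold euler_Gamma at 2.
  rewrite (intC_by_parts _ _ _ _ _ _ s _ _ B ltac:(lra) ltac:(lra) B' ltac:(lra) ltac:(lra)).
  2: { intros u. auto_derive; auto. ring. }
  replace (Copp _) with (Cmult (RtoC (-1)) (intC (fun u => Cmult (cexp s u) (RtoC (- exp u * exp (- exp u)))))) by ring.
  rewrite <- intC_cmult by (apply (Cdominated_cexp _ _ _ _ _ B'); lra).
  apply intC_ext. intros u. rewrite cexp_succ, RtoC_mult, RtoC_opp. ring.
Qed.

Lemma intC_RtoC (f : R -> R) : intC (fun u => RtoC (f u)) = RtoC (intR f).
Proof.
  unfold intC, RtoC; simpl. f_equal. unfold intR.
  rewrite (Lim_seq_ext _ (fun _ => 0)); [now rewrite Lim_seq_const|].
  intros n. rewrite RInt_const. unfold scal; simpl. unfold mult; simpl. ring.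
Qed.

Lemma euler_Gamma_real (x : R) : euler_Gamma (RtoC x) = RtoC (intR (fun u => exp (x * u) * exp (- exp u))).
Proof.
  rewrite <- intC_RtoC. apply intC_ext. intros u. now rewrite cexp_RtoC, <- RtoC_mult.
Qed.

Lemma dominated_euler_Gamma_real (x : R) : 0 < x -> exists K, dominated K (fun u => exp (x * u) * exp (- exp u)).
Proof.
  intros Hx. destruct (Cdominated_euler_Gamma (RtoC x)) as [K [HK _]]; [exact Hx|]. exists K.
  revert HK. apply dominated_ext. intros u. now rewrite cexp_RtoC, <- RtoC_mult.
Qed.

(** The positive integral over [[-1, 1]] is itself the tolerance in [intR_approx]: a larger window
    contributes at least as much and lies within it of the limit. Positivity is what lets
    [Gamma kappa] cancel at the end. *)
Lemma euler_Gamma_pos (x : R) : 0 < x -> 0 < Re (euler_Gamma (RtoC x)).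
Proof.
  intros Hx. rewrite euler_Gamma_real. change (0 < intR (fun u => exp (x * u) * exp (- exp u))).
  set (f := fun u => _). destruct (dominated_euler_Gamma_real x Hx) as [K HK]. fold f in HK.
  assert (Hf : forall u, 0 < f u) by (intros; apply Rmult_lt_0_compat; apply exp_pos).
  assert (P : 0 < RInt f (-1) 1) by (apply RInt_gt_0; [lra|auto|intros; apply HK]).
  destruct (intR_approx K f _ HK P) as [M [HM H]].
  specialize (H (- (M + 1)) (M + 1) ltac:(lra) ltac:(lra)).
  rewrite (RInt_split3 f (- (M + 1)) (-1) 1 (M + 1)) in H by apply HK.
  assert (0 <= RInt f (- (M + 1)) (-1)) by (apply RInt_ge_0; [lra|apply ex_RInt_cont, HK|intros; left; apply Hf]).
  assert (0 <= RInt f 1 (M + 1)) by (apply RInt_ge_0; [lra|apply ex_RInt_cont, HK|intros; left; apply Hf]).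
  apply Rabs_def2 in H. lra.
Qed.

Lemma euler_Gamma_1 : euler_Gamma (RtoC 1) = RtoC 1.
Proof.
  rewrite euler_Gamma_real. f_equal. destruct (dominated_euler_Gamma_real 1 ltac:(lra)) as [K HK].
  apply (intR_of_gen K); auto.
  (* The limits of the primitive [- exp (- exp u)] are 0 at plus infinity and -1 at minus
     infinity. *)
  cut (is_RInt_gen (fun u => exp (1 * u) * exp (- exp u)) (Rbar_locally m_infty) (Rbar_locally p_infty) (0 - -1)).
  { intros Q. now replace (0 - -1) with 1 in Q by ring. }
  assert (HD : forall u, is_derive (fun u => - exp (- exp u)) u (exp (1 * u) * exp (- exp u))).
  { intros u. rewrite (Rmult_1_l u). auto_derive; auto. ring. }
  assert (HD' : forall u, Derive (fun u => - exp (- exp u)) u = exp (1 * u) * exp (- exp u)).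
  { intros u. now apply is_derive_unique. }
  apply (is_RInt_gen_ext (V := R_NormedModule) (Derive (fun u => - exp (- exp u)))).
  { apply filter_forall. intros ab x _. apply HD'. }
  apply is_RInt_gen_Derive; try (apply filter_forall; intros ab x _).
  - eexists. apply HD.
  - eapply continuous_ext; [intros; symmetry; apply HD'|apply HK].
  - replace (-1) with (- exp (- 0)) by (rewrite Ropp_0, exp_0; ring).
    apply (filterlim_comp _ _ _ exp (fun y => - exp (- y)) _ (locally 0)).
    + apply is_lim_exp_m.
    + apply (ex_derive_continuous (V := R_NormedModule) (fun y => - exp (- y))). now auto_derive.
  - change (is_lim (fun u => - exp (- exp u)) p_infty 0).
    replace (Finite 0) with (Rbar_opp 0) by (simpl; now rewrite Ropp_0). apply is_lim_opp.
    apply (is_lim_comp exp (fun u => - exp u) p_infty 0 m_infty).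
    + apply is_lim_exp_m.
    + apply (is_lim_opp exp p_infty p_infty), is_lim_exp_p.
    + apply filter_forall. discriminate.
Qed.

(** * The Mellin transform of [ln (1 + x)] *)

(* [int_0^oo x^(s-1) ln (1 + x) dx] in the variable [x = e^u]. *)
Definition mellin_log (s : C) : C := intC (fun u => Cmult (cexp s u) (RtoC (softplus u))).

Lemma softplus_neg (u : R) : softplus u = u + softplus (- u).
Proof.
  apply exp_inv. rewrite exp_plus, !exp_softplus, Rmult_plus_distr_l, <- exp_plus, Rplus_opp_r, exp_0. ring.
Qed.

Lemma continuous_softplus (u : R) : continuous softplus u.
Proof.
  apply (ex_derive_continuous (V := R_NormedModule)). unfold softplus. auto_derive. pose proof (exp_pos u); lra.
Qed.

(** The logarithm grows more slowly than any [x^d], by [1 + d u <= e^(d u)], at the price of the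
    factor [/ d]. The strip is [-1 < Re s < -d], so [d] can be fitted to any [Re s] in [(-1, 0)]. *)
Lemma exp_bounded_softplus (d : R) : 0 < d <= 1 -> exp_bounded (/ d) 1 (- d) softplus.
Proof.
  intros Hd. split; [apply continuous_softplus|]. intros u. destruct (softplus_ge u) as [H1 [H2 H3]].
  assert (Hi : 1 <= / d) by (rewrite <- Rinv_1; apply Rinv_le_contravar; lra).
  rewrite Rabs_right, Ropp_involutive, Rmult_1_l by lra. pose proof (exp_pos u). split; [nra|].
  pose proof (exp_pos (d * u)). destruct (Rle_dec u 0).
  - assert (exp u <= exp (d * u)) by (apply exp_le_compat; nra). nra.
  - rewrite softplus_neg. destruct (softplus_ge (- u)) as [_ [_ H4]].
    assert (exp (- u) <= 1) by (rewrite <- exp_0; apply exp_le_compat; lra).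
    pose proof (exp_ineq1_le (d * u)).
    apply Rle_trans with (/ d * (1 + d * u)); [|apply Rmult_le_compat_l; lra].
    replace (/ d * (1 + d * u)) with (/ d + u) by (field; lra). lra.
Qed.

(** [x / (1 + x)] at [x = e^u], with the denominator in the shape that [euler_Gamma_mult] produces
    for [k = 1]. *)
Definition sigmoid (u : R) : R := exp u * exp (- (1) * softplus u).

Lemma exp_opp_softplus (u : R) : exp (- (1) * softplus u) = / (1 + exp u).
Proof. replace (- (1) * softplus u) with (- softplus u) by ring. now rewrite exp_Ropp, exp_softplus. Qed.

Lemma is_derive_softplus (u : R) : is_derive softplus u (sigmoid u).
Proof.
  unfold softplus at 1, sigmoid. pose proof (exp_pos u). auto_derive; [lra|]. rewrite exp_opp_softplus. field. lra.
Qed.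

Lemma is_derive_sigmoid (u : R) : is_derive sigmoid u (sigmoid u * exp (- (1) * softplus u)).
Proof.
  apply (is_derive_ext (fun u => exp u * / (1 + exp u))).
  { intros t. unfold sigmoid. now rewrite exp_opp_softplus. }
  unfold sigmoid. rewrite exp_opp_softplus. pose proof (exp_pos u). auto_derive; [lra|]. field. lra.
Qed.

Lemma continuous_exp_opp_softplus (u : R) : continuous (fun u => exp (- (1) * softplus u)) u.
Proof. apply (exp_bounded_pow 1 Rlt_0_1). Qed.

Lemma sigmoid_continuous (u : R) : continuous sigmoid u.
Proof. apply (continuous_mult (K := R_AbsRing)); [apply continuous_exp|apply continuous_exp_opp_softplus]. Qed.

Lemma sigmoid_bounds (u : R) : 0 < sigmoid u /\ sigmoid u <= exp u /\ sigmoid u <= 1.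
Proof.
  unfold sigmoid. rewrite exp_opp_softplus. pose proof (exp_pos u). assert (0 < / (1 + exp u)) by (apply Rinv_0_lt_compat; lra).
  assert (exp u * / (1 + exp u) + / (1 + exp u) = 1) by (field; lra).
  repeat split; nra.
Qed.

Lemma exp_bounded_sigmoid : exp_bounded 1 1 0 sigmoid.
Proof.
  split; [apply sigmoid_continuous|]. intros u. destruct (sigmoid_bounds u) as [H1 [H2 H3]].
  rewrite Rabs_right, !Rmult_1_l by lra. split; [lra|].
  replace (- 0 * u) with 0 by ring. rewrite exp_0; lra.
Qed.

Lemma exp_bounded_sigmoid_derive : exp_bounded 1 1 0 (fun u => sigmoid u * exp (- (1) * softplus u)).
Proof.
  apply (exp_bounded_le _ _ _ sigmoid); [|intros u|apply exp_bounded_sigmoid].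
  - intros u. apply (continuous_mult (K := R_AbsRing)); [apply sigmoid_continuous|apply continuous_exp_opp_softplus].
  - rewrite Rabs_mult. pose proof (Rabs_pos (sigmoid u)). rewrite (Rabs_right (exp _)) by (left; apply exp_pos).
    assert (exp (- (1) * softplus u) <= 1); [|nra].
    apply Rle_trans with (exp 0); [|right; apply exp_0]. apply exp_le_compat. destruct (softplus_ge u). lra.
Qed.

Lemma mellin_log_by_parts (s : C) : -1 < Re s < 0 ->
  Cmult s (mellin_log s) = Copp (intC (fun u => Cmult (cexp s u) (RtoC (sigmoid u)))).
Proof.
  intros Hs. pose proof (exp_bounded_softplus (- Re s / 2) ltac:(lra)) as B.
  apply (intC_by_parts _ _ _ _ _ _ s _ _ B ltac:(lra) ltac:(lra) exp_bounded_sigmoid); try lra.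
  apply is_derive_softplus.
Qed.

(** The beta identity with parameters [s + 1] and [-s], whose sum is 1. This integral stands in for
    the sine of the classical reflection formula. *)
Lemma intC_sigmoid (s : C) : -1 < Re s < 0 ->
  intC (fun u => Cmult (cexp s u) (RtoC (sigmoid u))) = Cmult (euler_Gamma (Cplus s (RtoC 1))) (euler_Gamma (Copp s)).
Proof.
  intros Hs. unfold Re in Hs. rewrite (euler_Gamma_mult _ _ 1); try (simpl; lra).
  - rewrite euler_Gamma_1, Cmult_1_l. apply intC_ext. intros u. unfold sigmoid. rewrite cexp_succ, RtoC_mult. ring.
  - ring.
Qed.

Lemma mellin_log_euler_Gamma (s : C) : -1 < Re s < 0 ->
  mellin_log s = Cdiv (Cmult (euler_Gamma (Cplus s (RtoC 1))) (euler_Gamma (Copp s))) (Copp s).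
Proof.
  intros Hs. assert (N : Copp s <> RtoC 0) by (apply Re_neq_0; simpl; unfold Re in Hs; lra).
  assert (N' : s <> RtoC 0) by (intros ->; apply N; ring).
  rewrite <- intC_sigmoid by auto.
  replace (intC (fun u => Cmult (cexp s u) (RtoC (sigmoid u)))) with (Copp (Cmult s (mellin_log s))).
  - field. auto.
  - rewrite mellin_log_by_parts by auto. ring.
Qed.

Lemma Cmod_intC (K : R) (f : R -> C) : dominated K (fun u => Re (f u)) -> dominated K (fun u => Im (f u)) ->
  Cmod (intC f) <= 2 * (K * PI).
Proof.
  intros H1 H2. apply intR_le in H1, H2.
  eapply Rle_trans; [apply Cmod_2Rmax|].
  assert (Rmax (Rabs (fst (intC f))) (Rabs (snd (intC f))) <= K * PI) by (now apply Rmax_lub).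
  assert (0 <= Rmax (Rabs (fst (intC f))) (Rabs (snd (intC f)))) by (eapply Rle_trans; [apply Rabs_pos|apply Rmax_l]).
  assert (sqrt 2 <= 2) by (rewrite <- (sqrt_square 2) at 2 by lra; apply sqrt_le_1_alt; lra).
  pose proof (sqrt_pos 2). nra.
Qed.

(* Integrating by parts twice gives the quadratic decay that makes the Mellin transform of
   [ln (1 + x)] integrable on vertical lines. *)
Lemma mellin_log_decay (c : R) : -1 < c < 0 -> exists K, forall t, Cmod (mellin_log (c, t)) <= K * / (1 + t ^ 2).
Proof.
  intros Hc. destruct (Cdominated_cexp_uniform 1 1 0 c ltac:(lra) ltac:(lra)) as [K HK].
  exists (2 * (K * PI) / c ^ 2). intros t. set (s := (c, t) : C).
  assert (E2 : Cmult (Cmult s s) (mellin_log s) = intC (fun u => Cmult (cexp s u) (RtoC (sigmoid u * exp (- (1) * softplus u))))).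
  { rewrite <- Cmult_assoc, mellin_log_by_parts by exact Hc.
    replace (Cmult s (Copp _)) with (Copp (Cmult s (intC (fun u => Cmult (cexp s u) (RtoC (sigmoid u)))))) by ring.
    rewrite (intC_by_parts _ _ _ _ _ _ s _ _ exp_bounded_sigmoid ltac:(simpl; lra) ltac:(simpl; lra) exp_bounded_sigmoid_derive); try (simpl; lra).
    - ring.
    - apply is_derive_sigmoid. }
  destruct (HK s _ eq_refl exp_bounded_sigmoid_derive) as [G1 G2].
  pose proof (Cmod_intC K _ G1 G2) as B. rewrite <- E2, !Cmod_mult in B.
  assert (Cmod s * Cmod s = c ^ 2 + t ^ 2).
  { unfold Cmod. rewrite sqrt_sqrt; [reflexivity|]. simpl. nra. }
  rewrite H in B. pose proof (Cmod_ge_0 (mellin_log s)).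
  (* Since [c^2 <= 1], the squared modulus [c^2 + t^2] of [s] is at least [c^2 (1 + t^2)]; this is
     the source of the division by [c^2] in the constant. *)
  assert (0 < c ^ 2) by nra. assert (c ^ 2 <= 1) by nra.
  apply (Rmult_le_reg_r (c ^ 2 * (1 + t ^ 2))); [nra|].
  replace (2 * (K * PI) / c ^ 2 * / (1 + t ^ 2) * (c ^ 2 * (1 + t ^ 2))) with (2 * (K * PI)) by (field; nra).
  assert (0 <= t ^ 2) by nra. assert (c ^ 2 * (1 + t ^ 2) <= c ^ 2 + t ^ 2) by nra. nra.
Qed.

Lemma cexp_pair (c t u : R) : cexp (c, t) u = Cmult (RtoC (exp (c * u))) (cexp Ci (t * u)).
Proof. unfold cexp, Ci, RtoC, Cmult; simpl. rewrite Rmult_0_l, exp_0, !Rmult_1_l. f_equal; ring. Qed.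

Lemma mellin_log_Cdominated (c : R) : -1 < c < 0 -> Cdominated (fun t => mellin_log (c, t)).
Proof.
  intros Hc. destruct (mellin_log_decay c Hc) as [K HK].
  destruct (Cdominated_cexp_uniform (/ (- c / 2)) 1 (- (- c / 2)) c ltac:(lra) ltac:(lra)) as [M HM].
  assert (HG : forall t, dominated M (fun u => Re (Cmult (cexp (c, t) u) (RtoC (softplus u)))) /\ dominated M (fun u => Im (Cmult (cexp (c, t) u) (RtoC (softplus u))))).
  { intros t. apply HM; [reflexivity|]. apply exp_bounded_softplus. lra. }
  assert (HC : Ccont2 (fun t u => Cmult (cexp (c, t) u) (RtoC (softplus u)))).
  { apply Ccont2_mult; [|apply (Ccont2_RtoC softplus); [apply continuous_softplus|apply cont2_2]].
    apply (Ccont2_ext (fun t u => Cmult (RtoC (exp (c * u))) (cexp Ci (t * u)))); [intros; now rewrite cexp_pair|].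
    apply Ccont2_mult.
    - apply (Ccont2_RtoC (fun u => exp (c * u))); [|apply cont2_2].
      intros u. apply (ex_derive_continuous (V := R_NormedModule)). now auto_derive.
    - apply Ccont2_cexp. intros x y. apply continuity_2d_pt_mult; [apply cont2_1|apply cont2_2]. }
  exists K. split; (split; intros t; [|eapply Rle_trans; [|apply HK]]).
  - apply (intR_param_continuous _ M (proj1 HC)). apply HG.
  - apply re_le_Cmod.
  - apply (intR_param_continuous _ M (proj2 HC)). apply HG.
  - apply Im_le_Cmod.
Qed.

(** * Mellin inversion by Abel summation *)

Lemma abel_continuous (e t : R) : continuous (fun t => exp (- e * Rabs t)) t.
Proof.
  apply (continuous_comp (fun t => - e * Rabs t) exp); [|apply continuous_exp].
  apply (continuous_scal_r (V := R_NormedModule)), continuous_Rabs.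
Qed.

(** The half-lines contribute [1 / (e + i u)] and [1 / (e - i u)], whose sum is the Poisson kernel
    up to the factor [2 pi]. *)
Lemma abel_kernel (e u : R) : 0 < e ->
  intC (fun t => Cmult (RtoC (exp (- e * Rabs t))) (cexp Ci (t * u))) = RtoC (2 * e / (e ^ 2 + u ^ 2)).
Proof.
  intros He.
  assert (N1 : (e, u) <> RtoC 0) by (apply Re_neq_0; exact He).
  assert (N2 : (- e, u) <> RtoC 0) by (intros H; apply (f_equal Re) in H; simpl in H; lra).
  assert (HE : forall c t, Cmult (RtoC (exp (c * t))) (cexp Ci (t * u)) = cexp (c, u) t).
  { intros c t. now rewrite cexp_pair, (Rmult_comm u t). }
  rewrite (intC_derive_split (fun t => Cmult (Cinv (e, u)) (cexp (e, u) t)) (fun t => Cmult (Cinv (- e, u)) (cexp (- e, u) t)) _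
    (fun t => Cmult (Cmult (Cinv (e, u)) (e, u)) (cexp (e, u) t)) (fun t => Cmult (Cmult (Cinv (- e, u)) (- e, u)) (cexp (- e, u) t))).
  - rewrite !cexp_0, !Cmult_1_r. unfold Cinv, Cminus, Cplus, Copp, RtoC; simpl. f_equal; field; nra.
  - apply (Cdominated_ext (fun t => Cmult (cexp (0, u) t) (RtoC (exp (- e * Rabs t))))).
    { intros t. rewrite <- HE, Rmult_0_l, exp_0. ring. }
    apply (Cdominated_cexp 1 e e); [|simpl; lra|simpl; lra]. split; [apply abel_continuous|].
    intros t. rewrite !Rmult_1_l, Rabs_right by (left; apply exp_pos). pose proof (Rle_abs t). pose proof (Rle_abs (- t)).
    rewrite Rabs_Ropp in *. split; apply exp_le_compat; nra.
  - intros t Ht. rewrite Cinv_l, Cmult_1_l by auto. rewrite <- HE, Rabs_left1 by lra. do 3 f_equal; ring.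
  - intros t Ht. rewrite Cinv_l, Cmult_1_l by auto. rewrite <- HE, Rabs_right by lra. do 3 f_equal; ring.
  - apply cder_cexp.
  - apply cder_cexp.
  - apply is_lim_cexp_m. exact He.
  - apply is_lim_cexp_p. simpl; lra.
Qed.

Lemma inv_S_small (eta : R) : 0 < eta -> eventually (fun n => / INR (S n) <= eta).
Proof.
  intros He. destruct (archimed_cor1 eta He) as [N [H1 H2]]. exists N. intros n Hn.
  apply Rle_trans with (/ INR N); [|lra]. apply Rinv_le_contravar; [now apply lt_0_INR|]. apply le_INR; lia.
Qed.

Lemma dominated_mult_le1 (K : R) (f g : R -> R) : dominated K f -> (forall x, continuous g x) ->
  (forall x, Rabs (g x) <= 1) -> dominated K (fun x => g x * f x).
Proof.
  intros [H1 H2] Hc Hg. split; intros x; [now apply (continuous_mult (K := R_AbsRing))|].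
  rewrite Rabs_mult. specialize (H2 x). specialize (Hg x). pose proof (Rabs_pos (f x)). pose proof (Rabs_pos (g x)). nra.
Qed.

Lemma Cdominated_phase (a : R) (f : R -> C) : Cdominated f -> Cdominated (fun t => Cmult (f t) (cexp Ci (a * t))).
Proof.
  intros [K [H1 H2]].
  assert (Hcos : forall x, continuous (fun t => cos (a * t)) x).
  { intros x. apply (ex_derive_continuous (V := R_NormedModule)). now auto_derive. }
  assert (Hsin : forall x, continuous (fun t => sin (a * t)) x).
  { intros x. apply (ex_derive_continuous (V := R_NormedModule)). now auto_derive. }
  assert (Bcos : forall x, Rabs (cos (a * x)) <= 1) by (intros; apply Rabs_le, COS_bound).
  assert (Bsin : forall x, Rabs (sin (a * x)) <= 1) by (intros; apply Rabs_le, SIN_bound).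
  eapply Cdominated_intro.
  - apply (dominated_ext _ (fun t => cos (a * t) * Re (f t) + (-1) * (sin (a * t) * Im (f t)))).
    { intros t. unfold cexp, Ci, Re, Im; simpl. rewrite Rmult_0_l, exp_0, !Rmult_1_l. ring. }
    apply dominated_plus; [|apply dominated_scal]; apply dominated_mult_le1; eassumption.
  - apply (dominated_ext _ (fun t => cos (a * t) * Im (f t) + sin (a * t) * Re (f t))).
    { intros t. unfold cexp, Ci, Re, Im; simpl. rewrite Rmult_0_l, exp_0, !Rmult_1_l. ring. }
    apply dominated_plus; apply dominated_mult_le1; eassumption.
Qed.

Lemma abel_le1 (e t : R) : 0 < e -> Rabs (exp (- e * Rabs t)) <= 1.
Proof.
  intros He. rewrite Rabs_right by (left; apply exp_pos). rewrite <- exp_0. apply exp_le_compat.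
  pose proof (Rabs_pos t). nra.
Qed.

Lemma abel_lim (K : R) (g : R -> R) : dominated K g ->
  is_lim_seq (fun n => intR (fun t => exp (- (/ INR (S n)) * Rabs t) * g t)) (intR g).
Proof.
  intros Hg. pose proof (dominated_K_pos _ _ Hg) as HK.
  assert (Hp : forall n, 0 < / INR (S n)) by (intros; apply Rinv_0_lt_compat, lt_0_INR; lia).
  apply (intR_dominated K); auto.
  { intros n. apply dominated_mult_le1; auto. intros; apply abel_continuous. intros; now apply abel_le1. }
  intros T eta HT He.
  assert (He' : 0 < eta / (T * (K + 1))) by (apply Rdiv_lt_0_compat; nra).
  destruct (inv_S_small _ He') as [N HN]. exists N. intros n Hn t Ht. specialize (HN n Hn).
  specialize (Hp n). set (e := / INR (S n)) in *.
  assert (Hgt : Rabs (g t) <= K).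
  { destruct Hg as [_ Hg]. specialize (Hg t). assert (/ (1 + t ^ 2) <= 1); [|nra].
    rewrite <- Rinv_1. apply Rinv_le_contravar; nra. }
  replace (exp (- e * Rabs t) * g t - g t) with ((exp (- e * Rabs t) - 1) * g t) by ring.
  rewrite Rabs_mult.
  assert (Rabs (exp (- e * Rabs t) - 1) <= e * T).
  { pose proof (abel_le1 e t Hp) as B. rewrite Rabs_right in B by (left; apply exp_pos).
    rewrite Rabs_left1 by lra. pose proof (exp_ineq1_le (- e * Rabs t)). pose proof (Rabs_pos t). nra. }
  apply Rle_trans with ((e * T) * K). { apply Rmult_le_compat; auto using Rabs_pos. }
  apply Rle_trans with (e * (T * (K + 1))); [nra|].
  apply (Rmult_le_compat_r (T * (K + 1))) in HN; [|nra].
  replace (eta / (T * (K + 1)) * (T * (K + 1))) with eta in HN by (field; nra). exact HN.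
Qed.

Lemma intR_cauchy (k : R) : dominated (Rabs k) (fun x => k * / (1 + x ^ 2)) /\ intR (fun x => k * / (1 + x ^ 2)) = k * PI.
Proof.
  assert (G1 : dominated 1 (fun x => / (1 + x ^ 2))).
  { split; intros x.
    - apply (ex_derive_continuous (V := R_NormedModule)). auto_derive. nra.
    - pose proof (cauchy_pos x). rewrite Rabs_right; lra. }
  split. { replace (Rabs k) with (Rabs k * 1) by ring. now apply dominated_scal. }
  rewrite (intR_scal 1) by auto. f_equal. apply (intR_unique 1); auto. intros eta He.
  destruct (atan_tail eta He) as [M [HM H]]. exists M. intros T HT. specialize (H T HT).
  rewrite (is_RInt_unique (V := R_CompleteNormedModule) _ _ _ _ (is_RInt_cauchy (- T) T)).
  rewrite atan_opp, Rabs_left; lra.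
Qed.

(** The substitution [u = e x] fixes the kernel as [2 / (1 + x^2)], of total mass [2 PI], and moves
    [e] into [h (e x + w)]. This tends to [h w] locally uniformly, and boundedness of [h] supplies
    the majorant. *)
Lemma poisson_lim (K w : R) (h : R -> R) : dominated K h ->
  is_lim_seq (fun n => let e := / INR (S n) in intR (fun u => h (u + w) * (2 * e / (e ^ 2 + u ^ 2)))) (2 * h w * PI).
Proof.
  intros Hh. pose proof (dominated_K_pos _ _ Hh) as HK.
  assert (Hp : forall n, 0 < / INR (S n)) by (intros; apply Rinv_0_lt_compat, lt_0_INR; lia).
  assert (Hb : forall u, Rabs (h u) <= K).
  { intros u. destruct Hh as [_ Hh]. specialize (Hh u). assert (/ (1 + u ^ 2) <= 1); [|nra].
    rewrite <- Rinv_1. apply Rinv_le_contravar; nra. }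
  destruct (intR_cauchy (2 * h w)) as [_ <-].
  apply (is_lim_seq_ext (fun n => intR (fun x => h (/ INR (S n) * x + w) * (2 * / (1 + x ^ 2))))).
  { intros n. cbv zeta. specialize (Hp n). set (e := / INR (S n)) in *.
    destruct (dominated_comp_lin K 1 w h Rlt_0_1 Hh) as [M HM].
    assert (G : dominated (2 / e * M) (fun u => h (u + w) * (2 * e / (e ^ 2 + u ^ 2)))).
    { split; intros u.
      - apply (continuous_mult (K := R_AbsRing) (fun u => h (u + w)) (fun u => 2 * e / (e ^ 2 + u ^ 2))).
        + apply (continuous_ext (fun u => h (1 * u + w))); [intros; now rewrite Rmult_1_l|apply HM].
        + apply (ex_derive_continuous (V := R_NormedModule)). auto_derive. nra.
      - destruct HM as [_ HM]. specialize (HM u). rewrite Rmult_1_l in HM. rewrite Rabs_mult.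
        assert (0 <= 2 * e / (e ^ 2 + u ^ 2) <= 2 / e).
        { split; [apply Rdiv_le_0_compat; nra|].
          assert (0 < e ^ 2 + u ^ 2) by nra.
          apply (Rmult_le_reg_r (e * (e ^ 2 + u ^ 2))); [now apply Rmult_lt_0_compat|].
          replace (2 * e / (e ^ 2 + u ^ 2) * (e * (e ^ 2 + u ^ 2))) with (2 * e ^ 2) by (field; nra).
          replace (2 / e * (e * (e ^ 2 + u ^ 2))) with (2 * (e ^ 2 + u ^ 2)) by (field; lra). nra. }
        rewrite (Rabs_right (2 * e / _)) by lra. pose proof (Rabs_pos (h (u + w))).
        apply Rle_trans with ((M * / (1 + u ^ 2)) * (2 / e)); [|right; ring].
        apply Rmult_le_compat; lra. }
    destruct (dominated_comp_lin _ e 0 _ Hp G) as [N HN].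
    rewrite <- (intR_comp_lin _ _ e 0 _ Hp G (dominated_scal _ e _ HN)). apply intR_ext. intros x.
    rewrite Rplus_0_r. field. nra. }
  assert (HD : forall x, 0 < 2 * / (1 + x ^ 2) <= 2).
  { intros x. pose proof (cauchy_pos x). assert (/ (1 + x ^ 2) <= 1); [|lra].
    rewrite <- Rinv_1. apply Rinv_le_contravar; nra. }
  apply (intR_dominated (2 * K)).
  - intros n. split; intros x.
    + apply (continuous_mult (K := R_AbsRing) (fun x => h (/ INR (S n) * x + w)) (fun x => 2 * / (1 + x ^ 2))).
      * destruct (dominated_comp_lin K (/ INR (S n)) w h (Hp n) Hh) as [M HM]. apply HM.
      * apply (ex_derive_continuous (V := R_NormedModule)). auto_derive. nra.
    + rewrite Rabs_mult, (Rabs_right (2 * _)) by (left; apply HD). specialize (Hb (/ INR (S n) * x + w)).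
      pose proof (cauchy_pos x). nra.
  - apply (dominated_weaken (Rabs (2 * h w))); [|apply intR_cauchy].
    rewrite Rabs_mult, Rabs_right by lra. specialize (Hb w). lra.
  - intros T eta HT He. destruct Hh as [Hc _].
    specialize (Hc w). apply continuity_pt_filterlim in Hc.
    destruct (Hc (eta / 2) ltac:(lra)) as [d [Hd Hx]].
    assert (Hd' : 0 < d / (2 * T)) by (apply Rdiv_lt_0_compat; lra).
    destruct (inv_S_small _ Hd') as [N HN]. exists N. intros n Hn x HxT. specialize (HN n Hn).
    specialize (Hp n). set (e := / INR (S n)) in *.
    assert (Hex : Rabs (e * x) < d).
    { rewrite Rabs_mult, Rabs_right by lra. pose proof (Rabs_pos x).
      apply (Rmult_le_compat_r T) in HN; [|lra].
      replace (d / (2 * T) * T) with (d / 2) in HN by (field; lra). nra. }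
    replace (_ - _) with ((h (e * x + w) - h w) * (2 * / (1 + x ^ 2))) by ring.
    rewrite Rabs_mult, (Rabs_right (2 * _)) by (left; apply HD).
    assert (Rabs (h (e * x + w) - h w) <= eta / 2).
    (* The definition of [continuity_pt] excludes the base point, so [e * x = 0] is treated
       apart. *)
    { destruct (Req_dec (e * x) 0) as [Z|Z].
      - rewrite Z, Rplus_0_l, Rminus_diag, Rabs_R0. lra.
      - left. apply (Hx (e * x + w)). split.
        + split; [exact I|]. lra.
        + simpl. unfold Rdist. now replace (e * x + w - w) with (e * x) by ring. }
    specialize (HD x). pose proof (Rabs_pos (h (e * x + w) - h w)). nra.
Qed.

(** Damping by [exp (- e * Rabs t)] makes the integral over [t] and [u] absolutely convergent; after
    Fubini the [t]-integral is the Poisson kernel. As [e = / INR (S n)] tends to 0, the damped side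
    converges because [mellin_log] is dominated on the line, the other side by [poisson_lim]. The
    imaginary part is already 0 for every [e]. *)
Lemma mellin_log_inversion (c w : R) : -1 < c < 0 ->
  intC (fun t => Cmult (mellin_log (c, t)) (cexp Ci (- w * t))) = RtoC (2 * PI * (exp (c * w) * softplus w)).
Proof.
  intros Hc. set (h := fun u => exp (c * u) * softplus u).
  assert (Gc : forall t, Cdominated (fun u => Cmult (cexp (c, t) u) (RtoC (softplus u)))).
  { intros t. apply (Cdominated_cexp _ _ _ _ _ (exp_bounded_softplus (- c / 2) ltac:(lra))); simpl; lra. }
  destruct (Gc 0) as [K [Hh _]].
  assert (Hh' : dominated K h).
  { revert Hh. apply dominated_ext. intros u. rewrite cexp_pair, Rmult_0_l, cexp_0. unfold h, Re; simpl. ring. }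
  destruct (dominated_comp_lin K 1 w h Rlt_0_1 Hh') as [M HM].
  assert (HF : forall t, Cmult (mellin_log (c, t)) (cexp Ci (- w * t)) = intC (fun u => Cmult (RtoC (h (u + w))) (cexp Ci (t * u)))).
  { intros t. rewrite Cmult_comm. unfold mellin_log.
    (* Replacing [u] by [u + w] absorbs the phase [- w * t], which centres the Poisson kernel at
       [u = 0]. *)
    rewrite <- (intC_shift w), <- intC_cmult.
    - apply intC_ext. intros u. rewrite cexp_pair. unfold h. rewrite RtoC_mult.
      replace (t * u) with (- w * t + t * (u + w)) by ring. rewrite cexp_plus_r. ring.
    - apply (Cdominated_ext (fun u => Cmult (cexp (c, t) (1 * u + w)) (RtoC (softplus (1 * u + w))))); [intros; now rewrite Rmult_1_l|].
      exact (Cdominated_comp_lin 1 w _ Rlt_0_1 (Gc t)).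
    - apply Gc. }
  pose proof (Cdominated_phase (- w) _ (mellin_log_Cdominated c Hc)) as [P [P1 P2]].
  set (F := fun t => Cmult (mellin_log (c, t)) (cexp Ci (- w * t))) in *.
  assert (HA : forall n, let e := / INR (S n) in
    intC (fun t => Cmult (RtoC (exp (- e * Rabs t))) (F t)) = RtoC (intR (fun u => h (u + w) * (2 * e / (e ^ 2 + u ^ 2))))).
  { intros n. cbv zeta. assert (Hp : 0 < / INR (S n)) by (apply Rinv_0_lt_compat, lt_0_INR; lia).
    set (e := / INR (S n)) in *.
    assert (He : forall t, Cdominated (fun u => Cmult (RtoC (h (u + w))) (cexp Ci (t * u)))).
    { intros t. apply Cdominated_phase. apply (Cdominated_intro M 0).
      - revert HM. apply dominated_ext. intros u. now rewrite Rmult_1_l.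
      - split; intros u; [apply continuous_const|]. simpl. rewrite Rabs_R0. lra. }
    rewrite (intC_ext _ (fun t => intC (fun u => Cmult (RtoC (exp (- e * Rabs t))) (Cmult (RtoC (h (u + w))) (cexp Ci (t * u)))))).
    2: { intros t. rewrite intC_cmult by auto. unfold F. now rewrite HF. }
    rewrite intC_Fubini.
    - rewrite <- intC_RtoC. apply intC_ext. intros u. rewrite RtoC_mult, <- abel_kernel by auto.
      rewrite <- intC_cmult.
      + apply intC_ext. intros t. ring.
      + apply (Cdominated_ext (fun t => Cmult (RtoC (exp (- e * Rabs t))) (cexp Ci (u * t)))); [intros; now rewrite Rmult_comm with (r1 := u)|].
        apply Cdominated_phase. apply (Cdominated_intro (1 + 4 / e ^ 2) 0).
        * split; intros t; [apply abel_continuous|]. simpl. rewrite Rabs_right by (left; apply exp_pos).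
          now apply exp_abs_cauchy.
        * split; intros t; [apply continuous_const|]. simpl. rewrite Rabs_R0. lra.
    - apply (Cdominated2_intro ((1 + 4 / e ^ 2) * M)).
      + apply Ccont2_mult; [|apply Ccont2_mult].
        * apply (Ccont2_RtoC (fun t => exp (- e * Rabs t))); [apply abel_continuous|apply cont2_1].
        * apply (Ccont2_RtoC (fun u => h (u + w))); [|apply cont2_2].
          intros u. apply (continuous_ext (fun u => h (1 * u + w))); [intros; now rewrite Rmult_1_l|apply HM].
        * apply Ccont2_cexp. intros x y. apply continuity_2d_pt_mult; [apply cont2_1|apply cont2_2].
      + intros t u. rewrite !Cmod_mult, !Cmod_R, Cmod_cexp. simpl Re. rewrite Rmult_0_l, exp_0, Rmult_1_r.
        rewrite (Rabs_right (exp _)) by (left; apply exp_pos).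
        pose proof (exp_abs_cauchy e t Hp) as B1. destruct HM as [_ HM]. specialize (HM u). rewrite Rmult_1_l in HM.
        pose proof (exp_pos (- e * Rabs t)). pose proof (Rabs_pos (h (u + w))).
        apply Rle_trans with (((1 + 4 / e ^ 2) * / (1 + t ^ 2)) * (M * / (1 + u ^ 2))); [|right; ring].
        apply Rmult_le_compat; lra. }
  pose proof (poisson_lim K w h Hh') as LP. cbv zeta in LP.
  apply injective_projections.
  - assert (L1 : is_lim_seq (fun n => intR (fun u => h (u + w) * (2 * / INR (S n) / ((/ INR (S n)) ^ 2 + u ^ 2)))) (intR (fun t => Re (F t)))).
    { apply (is_lim_seq_ext (fun n => intR (fun t => exp (- (/ INR (S n)) * Rabs t) * Re (F t)))); [|now apply (abel_lim P)].
      intros n. specialize (HA n). cbv zeta in HA. apply (f_equal Re) in HA. unfold intC in HA. cbn [Re fst RtoC] in HA.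
      rewrite <- HA. apply intR_ext. intros t. simpl. unfold Re. ring. }
    apply is_lim_seq_unique in L1. apply is_lim_seq_unique in LP. rewrite LP in L1. injection L1 as L1.
    simpl. unfold F in L1. rewrite <- L1. unfold h. ring.
  - assert (L1 : is_lim_seq (fun n => 0) (intR (fun t => Im (F t)))).
    { apply (is_lim_seq_ext (fun n => intR (fun t => exp (- (/ INR (S n)) * Rabs t) * Im (F t)))); [|now apply (abel_lim P)].
      intros n. specialize (HA n). cbv zeta in HA. apply (f_equal Im) in HA. unfold intC in HA. cbn [Im snd RtoC] in HA.
      rewrite <- HA. apply intR_ext. intros t. simpl. unfold Re, Im. ring. }
    apply is_lim_seq_unique in L1. rewrite Lim_seq_const in L1. injection L1 as L1. simpl. symmetry. exact L1.
Qed.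

(** * The Mellin--Barnes integral *)

Lemma Cdominated2_intC (F : R -> R -> C) : Cdominated2 F -> Cdominated (fun x => intC (F x)).
Proof.
  intros [K [H1 H2]]. exists (K * PI). split; now apply dominated2_intR.
Qed.

Lemma Cdominated2_swap (F : R -> R -> C) : Cdominated2 F -> Cdominated2 (fun x y => F y x).
Proof. intros [K [H1 H2]]. exists K. split; apply dominated2_swap; assumption. Qed.

Lemma is_RInt_gen_intC (f : R -> C) : Cdominated f ->
  is_RInt_gen (V := prod_NormedModule R_AbsRing R_NormedModule R_NormedModule) f
    (Rbar_locally m_infty) (Rbar_locally p_infty) (intC f).
Proof.
  intros [K [H1 H2]] P [eps HP].
  destruct (intR_approx K _ eps H1) as [M1 [_ HM1]]; [apply eps|].
  destruct (intR_approx K _ eps H2) as [M2 [_ HM2]]; [apply eps|].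
  pose proof (Rmax_l M1 M2). pose proof (Rmax_r M1 M2).
  exists (fun a => a < - Rmax M1 M2) (fun b => Rmax M1 M2 < b); [now exists (- Rmax M1 M2)|now exists (Rmax M1 M2)|].
  intros a b Ha Hb. exists (RInt (fun x => Re (f x)) a b, RInt (fun x => Im (f x)) a b). split.
  - apply is_RInt_fct_extend_pair; simpl;
    apply (RInt_correct (V := R_CompleteNormedModule)); apply ex_RInt_cont; [apply H1|apply H2].
  - apply HP. split; apply (norm_compat1 (V := R_NormedModule)).
    + change (Rabs (RInt (fun x => Re (f x)) a b - intR (fun x => Re (f x))) < eps).
      rewrite Rabs_minus_sym. apply HM1; lra.
    + change (Rabs (RInt (fun x => Im (f x)) a b - intR (fun x => Im (f x))) < eps).
      rewrite Rabs_minus_sym. apply HM2; lra.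
Qed.

(** The substitution [v = ln (x z)], with [dv = dx / x]. In the application [x z] is the normalised
    variable of the Beta-prime density, so the density becomes elementary in [e^v]. *)
Lemma is_RInt_gen_log_subst (K k z : R) (f g : R -> R) : 0 < z -> dominated K f ->
  (forall x, 0 < x -> g x = k * (/ x * f (ln (x * z)))) ->
  is_RInt_gen g (at_right 0) (Rbar_locally p_infty) (k * intR f).
Proof.
  intros Hz Hf Hg P [eps HP].
  assert (He : 0 < eps / (Rabs k + 1)).
  { apply Rdiv_lt_0_compat; [apply eps|]. pose proof (Rabs_pos k); lra. }
  destruct (intR_approx K f _ Hf He) as [M [HM H]].
  assert (Hd : 0 < exp (- M) / z) by (apply Rdiv_lt_0_compat; [apply exp_pos|auto]).
  assert (Hlt : exp (- M) / z < exp M / z).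
  { apply Rmult_lt_compat_r; [now apply Rinv_0_lt_compat|]. apply exp_increasing; lra. }
  exists (fun a => 0 < a < exp (- M) / z) (fun b => exp M / z < b).
  - exists (mkposreal _ Hd). intros a Ha Ha0. split; auto.
    change (Rabs (a - 0) < exp (- M) / z) in Ha. rewrite Rminus_0_r in Ha. apply Rabs_def2 in Ha. apply Ha.
  - now exists (exp M / z).
  - intros a b Ha Hb. exists (k * RInt f (ln (a * z)) (ln (b * z))). split.
    + apply (is_RInt_ext (fun x => scal k (scal (/ x) (f (ln (x * z)))))).
      { simpl. rewrite Rmin_left by lra. intros x Hx. symmetry. apply Hg. lra. }
      apply (is_RInt_scal (V := R_NormedModule)).
      apply (is_RInt_comp (V := R_CompleteNormedModule) f (fun x => ln (x * z)) (fun x => / x)).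
      * intros x _. apply Hf.
      * simpl. rewrite Rmin_left by lra. intros x Hx. assert (0 < x * z) by (apply Rmult_lt_0_compat; lra). split.
        -- auto_derive; [auto|]. field. lra.
        -- apply (ex_derive_continuous (V := R_NormedModule)). auto_derive. lra.
    + apply HP. apply (norm_compat1 (V := R_NormedModule)).
      change (Rabs (k * RInt f (ln (a * z)) (ln (b * z)) - k * intR f) < eps).
      assert (La : ln (a * z) <= - M).
      { rewrite <- (ln_exp (- M)). apply ln_le; [apply Rmult_lt_0_compat; lra|].
        destruct Ha as [_ Ha]. apply (Rmult_lt_compat_r z) in Ha; auto.
        replace (exp (- M) / z * z) with (exp (- M)) in Ha by (field; lra). lra. }
      assert (Lb : M <= ln (b * z)).
      { rewrite <- (ln_exp M) at 1. apply ln_le; [apply exp_pos|].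
        apply (Rmult_lt_compat_r z) in Hb; auto.
        replace (exp M / z * z) with (exp M) in Hb by (field; lra). lra. }
      specialize (H _ _ La Lb). rewrite Rabs_minus_sym in H.
      rewrite <- Rmult_minus_distr_l, Rabs_mult. pose proof (Rabs_pos k). pose proof (cond_pos eps).
      assert (E1 : eps = eps / (Rabs k + 1) * (Rabs k + 1) :> R) by (field; lra).
      rewrite E1. set (q := eps / (Rabs k + 1)) in *. pose proof (Rabs_pos (RInt f (ln (a * z)) (ln (b * z)) - intR f)). nra.
Qed.

(** The six Gamma factors fall into two groups: [Gamma(1+s) Gamma(-s) * Gamma(-s) / Gamma(1-s)],
    which is [mellin_log s] because [Gamma(1-s) = -s Gamma(-s)], and [Gamma(kZ-s) Gamma(kW+s)], to
    which the beta identity applies since the arguments sum to the real number [kZ + kW]. *)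
Lemma meijerG_integrand_mellin_log (kZ kW c z t : R) : 0 < kZ -> -1 < c < 0 -> - kW < c ->
  meijerG_integrand 3 2 [0; 1 - kW; 1] [0; 0; kZ] z (c, t) =
  Cmult (euler_Gamma (RtoC (kZ + kW))) (Cmult (Cmult (mellin_log (c, t)) (cexp (c, t) (ln z)))
    (intC (fun v => Cmult (cexp (Cminus (RtoC kZ) (c, t)) v) (RtoC (exp (- (kZ + kW) * softplus v)))))).
Proof.
  intros HZ Hc HW. unfold meijerG_integrand. cbn [firstn skipn map Cprod_list].
  set (s := (c, t) : C). change (Cpowr z s) with (cexp s (ln z)).
  assert (E1 : Cminus (RtoC 0) s = Copp s) by ring.
  assert (E2 : Cplus (RtoC (1 - 0)) s = Cplus s (RtoC 1)) by (rewrite Rminus_0_r; ring).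
  assert (E3 : Cplus (RtoC (1 - (1 - kW))) s = Cplus (RtoC kW) s) by (do 2 f_equal; ring).
  assert (E4 : Cminus (RtoC 1) s = Cplus (Copp s) (RtoC 1)) by ring.
  rewrite E1, E2, E3, E4.
  rewrite !CGamma_euler_Gamma by (unfold s; simpl; lra).
  assert (Hs : 0 < Re (Copp s)) by (unfold s; simpl; lra).
  rewrite (euler_Gamma_succ (Copp s) Hs). pose proof (Re_neq_0 _ Hs) as N.
  assert (M : Cmult (euler_Gamma (Cminus (RtoC kZ) s)) (euler_Gamma (Cplus (RtoC kW) s)) =
    Cmult (euler_Gamma (RtoC (kZ + kW))) (intC (fun v => Cmult (cexp (Cminus (RtoC kZ) s) v) (RtoC (exp (- (kZ + kW) * softplus v)))))).
  { apply euler_Gamma_mult; [unfold s; simpl; lra|unfold s; simpl; lra|]. rewrite RtoC_plus. ring. }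
  transitivity (Cmult (Cmult (mellin_log s) (cexp s (ln z))) (Cmult (euler_Gamma (Cminus (RtoC kZ) s)) (euler_Gamma (Cplus (RtoC kW) s)))).
  2: { rewrite M. ring. }
  rewrite (mellin_log_euler_Gamma s) by exact Hc.
  (* Since [0 / 0 = 0], no non-vanishing of the Gamma function is needed here. *)
  destruct (Ceq_dec (euler_Gamma (Copp s)) (RtoC 0)) as [Z|Z].
  - rewrite Z. unfold Cdiv. ring.
  - assert (s <> RtoC 0) by (intros Q; apply N; rewrite Q; ring). field. split; auto.
Qed.

Lemma mellin_barnes (kZ kW c z : R) : 0 < kZ -> 0 < kW -> 0 < z -> -1 < c < 0 -> - kW < c ->
  let f0 := fun v => exp (kZ * v) * exp (- (kZ + kW) * softplus v) * softplus (v - ln z) in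
  (exists K, dominated K f0) /\
  is_RInt_gen (V := prod_NormedModule R_AbsRing R_NormedModule R_NormedModule)
    (fun t => meijerG_integrand 3 2 [0; 1 - kW; 1] [0; 0; kZ] z (c, t))
    (Rbar_locally m_infty) (Rbar_locally p_infty)
    (Cmult (RtoC (2 * PI)) (Cmult (euler_Gamma (RtoC (kZ + kW))) (RtoC (intR f0)))).
Proof.
  intros HZ HW Hz Hc HWc f0.
  (* [g] collects the moduli of [z^s] and of the [v]-integrand; their phases merge into
     [e^(-i (v - ln z) t)], so the integral over [t] is the inversion formula at [w = v - ln z]. *)
  set (g := fun v => exp (c * ln z) * (exp ((kZ - c) * v) * exp (- (kZ + kW) * softplus v))).
  set (F := fun t v => Cmult (mellin_log (c, t)) (Cmult (RtoC (g v)) (cexp Ci (- (v - ln z) * t)))).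
  pose proof (exp_bounded_pow (kZ + kW) ltac:(lra)) as BP.
  assert (Hg : exists K, dominated K g).
  { destruct (Cdominated_cexp _ _ _ (RtoC (kZ - c)) _ BP) as [K [HK _]]; [simpl; lra|simpl; lra|].
    exists (Rabs (exp (c * ln z)) * K). apply dominated_scal. revert HK. apply dominated_ext.
    intros v. now rewrite cexp_RtoC, <- RtoC_mult. }
  destruct Hg as [Kg Hg]. destruct (mellin_log_decay c Hc) as [Kp Hp].
  destruct (mellin_log_Cdominated c Hc) as [K0 [HP1 HP2]].
  assert (HF : Cdominated2 F).
  { apply (Cdominated2_intro (Kp * Kg)).
    - apply Ccont2_mult; [|apply Ccont2_mult].
      + apply (Ccont2_comp (fun t => mellin_log (c, t)) (fun t v => t)); [apply HP1|apply HP2|apply cont2_1].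
      + apply (Ccont2_RtoC g); [apply Hg|apply cont2_2].
      + apply Ccont2_cexp. intros x y. apply continuity_2d_pt_mult; [|apply cont2_1].
        apply continuity_2d_pt_opp, continuity_2d_pt_minus; [apply cont2_2|apply continuity_2d_pt_const].
    - intros t v. unfold F. rewrite !Cmod_mult, Cmod_R, Cmod_cexp. simpl Re. rewrite Rmult_0_l, exp_0, Rmult_1_r.
      destruct Hg as [_ Hg]. specialize (Hg v). specialize (Hp t).
      apply Rle_trans with ((Kp * / (1 + t ^ 2)) * (Kg * / (1 + v ^ 2))); [|right; ring].
      apply Rmult_le_compat; auto using Cmod_ge_0, Rabs_pos. }
  assert (Ev : forall v, intC (fun t => F t v) = RtoC (2 * PI * f0 v)).
  { intros v. rewrite (intC_ext _ (fun t => Cmult (RtoC (g v)) (Cmult (mellin_log (c, t)) (cexp Ci (- (v - ln z) * t))))) by (intros; unfold F; ring).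
    rewrite intC_cmult by now apply Cdominated_phase, mellin_log_Cdominated.
    rewrite mellin_log_inversion, <- RtoC_mult by auto. f_equal. unfold g, f0.
    (* All exponents containing [c] cancel here, which is why the value does not depend on the
       chosen line. *)
    replace (exp (kZ * v)) with (exp (c * ln z) * exp ((kZ - c) * v) * exp (c * (v - ln z))) by (rewrite <- !exp_plus; f_equal; ring).
    ring. }
  assert (Hf0 : exists K, dominated K f0).
  (* Up to the factor [2 * PI], [f0] is the [t]-integral of [F], and so inherits a majorant from the
     double integral. *)
  { destruct (Cdominated2_intC _ (Cdominated2_swap _ HF)) as [K [HK _]]. exists (Rabs (/ (2 * PI)) * K).
    apply (dominated_ext _ (fun v => / (2 * PI) * Re (intC (fun t => F t v)))).
    - intros v. rewrite Ev. simpl. field. apply PI_neq0.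
    - now apply dominated_scal. }
  split; auto. destruct Hf0 as [K Hf0].
  assert (Et : forall t, intC (F t) = Cmult (Cmult (mellin_log (c, t)) (cexp (c, t) (ln z)))
      (intC (fun v => Cmult (cexp (Cminus (RtoC kZ) (c, t)) v) (RtoC (exp (- (kZ + kW) * softplus v)))))).
  { intros t. rewrite <- intC_cmult.
    - apply intC_ext. intros v. unfold F, g. rewrite (cexp_pair c t).
      change (Cminus (RtoC kZ) (c, t)) with (kZ - c, 0 - t). rewrite (cexp_pair (kZ - c)).
      replace (- (v - ln z) * t) with (t * ln z + (0 - t) * v) by ring.
      rewrite cexp_plus_r, !RtoC_mult. ring.
    - apply (Cdominated_cexp _ _ _ _ _ BP); simpl; lra. }
  assert (HI : intC (fun t => meijerG_integrand 3 2 [0; 1 - kW; 1] [0; 0; kZ] z (c, t)) =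
    Cmult (RtoC (2 * PI)) (Cmult (euler_Gamma (RtoC (kZ + kW))) (RtoC (intR f0)))).
  { rewrite (intC_ext _ (fun t => Cmult (euler_Gamma (RtoC (kZ + kW))) (intC (F t)))).
    2: { intros t. rewrite Et. now apply meijerG_integrand_mellin_log. }
    rewrite intC_cmult by now apply Cdominated2_intC. rewrite intC_Fubini by auto.
    rewrite (intC_ext _ (fun v => RtoC (2 * PI * f0 v)) Ev), intC_RtoC, (intR_scal K) by auto.
    rewrite (RtoC_mult (2 * PI)). ring. }
  rewrite <- HI. apply is_RInt_gen_intC.
  apply (Cdominated_ext (fun t => Cmult (euler_Gamma (RtoC (kZ + kW))) (intC (F t)))).
  - intros t. rewrite Et. symmetry. now apply meijerG_integrand_mellin_log.
  - now apply Cdominated_cmult, Cdominated2_intC.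
Qed.

Theorem theorem2 (kZ thZ mu mu2 rho zeta c : R) :
  0 < kZ -> 0 < thZ -> 0 < mu -> mu ^ 2 < mu2 -> 0 < rho -> 0 < zeta ->
  let kW := mu ^ 2 / (mu2 - mu ^ 2) in
  let thW := (mu2 - mu ^ 2) / mu in
  let kappa := kZ + kW in
  let Lambda := Beta kZ kW * Gamma kappa in
  let z := thW / (rho * zeta * thZ) in
  let a := [0; 1 - kW; 1] in
  let b := [0; 0; kZ] in
  admissible_line 3 2 a b c ->
  exists (Rate : R) (G : C),
    is_RInt_gen (fun x => log2 (1 + x) * f_gamma kZ thZ kW thW rho zeta x)
                (at_right 0) (Rbar_locally p_infty) Rate /\
    is_meijerG_line 3 2 a b c z G /\
    RtoC Rate = Cmult (RtoC (1 / (ln 2 * Lambda))) G.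
Proof.
  intros HkZ HthZ Hmu Hmu2 Hrho Hzeta kW thW kappa Lambda z a b [Hb Ha].
  assert (HkW : 0 < kW) by (apply Rdiv_lt_0_compat; nra).
  assert (HthW : 0 < thW) by (apply Rdiv_lt_0_compat; lra).
  assert (Hden : 0 < rho * zeta * thZ) by (repeat apply Rmult_lt_0_compat; auto).
  assert (Hz : 0 < z) by (now apply Rdiv_lt_0_compat).
  (* The first entries of [b] and [a] confine [c] to the strip where [mellin_log] converges; the
     second entry of [a] keeps [Re (kW + s)] positive. *)
  assert (Hc : -1 < c < 0).
  { specialize (Hb 0%nat ltac:(lia)). specialize (Ha 0%nat ltac:(lia)). simpl in Hb, Ha. lra. }
  assert (HcW : - kW < c).
  { specialize (Ha 1%nat ltac:(lia)). simpl in Ha. lra. }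
  destruct (mellin_barnes kZ kW c z HkZ HkW Hz Hc HcW) as [[K HK] HG].
  set (f0 := fun v => exp (kZ * v) * exp (- (kZ + kW) * softplus v) * softplus (v - ln z)) in *.
  (* Rate and G-function are both multiples of [intR f0], with the constants from the density and
     from [mellin_barnes]. *)
  exists (/ (ln 2 * Beta kZ kW) * intR f0), (Cmult (euler_Gamma (RtoC kappa)) (RtoC (intR f0))).
  split; [|split; [exact HG|]].
  - apply (is_RInt_gen_log_subst K _ z f0); auto. intros x Hx.
    assert (Hxz : 0 < x * z) by (now apply Rmult_lt_0_compat).
    unfold f_gamma, log2, f0, softplus, Rpower. cbv zeta.
    replace (x * thW / (rho * zeta * thZ)) with (x * z) by (unfold z; field; lra).
    rewrite (exp_ln (x * z)) by auto.
    replace (ln (x * z) - ln z) with (ln x) by (rewrite ln_mult by auto; ring).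
    rewrite (exp_ln x) by auto.
    replace (exp ((kZ - 1) * ln (x * z))) with (exp (kZ * ln (x * z)) * / (x * z)).
    2: { replace ((kZ - 1) * ln (x * z)) with (kZ * ln (x * z) + - ln (x * z)) by ring.
      now rewrite exp_plus, exp_Ropp, exp_ln. }
    replace (thW / (rho * zeta * thZ * Beta kZ kW)) with (z * / Beta kZ kW).
    2: { unfold z, Rdiv. rewrite !Rinv_mult. ring. }
    unfold Rdiv. rewrite !Rinv_mult.
    (* The [z] comes from the prefactor of the density, the [/ z] from lowering the exponent [kZ] to
       [kZ - 1]; the remaining [/ x] is the Jacobian of the substitution. *)
    transitivity ((z * / z) * (/ ln 2 * / Beta kZ kW * (/ x * (exp (kZ * ln (x * z)) *
      exp (- (kZ + kW) * ln (1 + x * z)) * ln (1 + x))))); [ring|].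
    rewrite Rinv_r by lra. ring.
  - pose proof (euler_Gamma_pos kappa ltac:(unfold kappa; lra)) as Hpos.
    assert (EG : euler_Gamma (RtoC kappa) = RtoC (Gamma kappa)).
    { unfold Gamma. rewrite CGamma_euler_Gamma by (simpl; unfold kappa; lra). rewrite euler_Gamma_real. reflexivity. }
    rewrite EG in *. simpl in Hpos. rewrite <- !RtoC_mult. f_equal.
    unfold Lambda, Rdiv. rewrite !Rinv_mult.
    transitivity ((Gamma kappa * / Gamma kappa) * (/ ln 2 * / Beta kZ kW * intR f0)); [|ring].
    rewrite Rinv_r by lra. ring.
Qed.
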